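(* Let $H$ be a semisimple Hopf algebra over an algebraically closed field $K$ of characteristic zero. Suppose that $V$ is a finite-dimensional $H$-module with character $\chi$ and exponent $d$, and that $m$ is a natural number. (1) If $m$ is large compared to $d$, then $\nu_m(\chi)$ is an integer. (2) If $d$ is squarefree, then $\nu_m(\chi)$ is always an integer.
   Context: A semisimple Hopf algebra is finite-dimensional, and contains a unique two-sided integral $\Lambda$ with $\varepsilon(\Lambda)=1$, where $\varepsilon$ is the counit. For $h\in H$ and $m\ge 1$, put $h^{[m]} := h_{(1)}h_{(2)}\cdots h_{(m)}$ (Sweedler notation for the iterated coproduct). The $m$-th Frobenius-Schur indicator of a character $\chi$ of $H$ is $\nu_m(\chi):=\chi(\Lambda^{[m]})\in K$; ''integer'' means an element of $\mathbb{Z}\subset K$. The exponent of an $H$-module $V$ is the smallest natural number $d\geq 1$ such that $h^{[d]}.v=\varepsilon(h)v$ for all $h\in H$ and $v\in V$ (for the Hopf algebras considered here, such a number exists by a theorem of Etingof and Gelaki). For natural numbers $m,d$, we say that $m$ is large compared to $d$ if for every prime $p$ that divides both $d$ and $m$, writing $d=p^kq$ with $p\nmid q$, the power $p^k$ divides $m$. Modules are left modules. *)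

(* Defs.v *)
From HB Require Import structures.
From mathcomp Require Import all_boot all_order all_algebra all_field.

Set Implicit Arguments.
Unset Strict Implicit.
Unset Printing Implicit Defensive.

Import GRing.Theory.
Local Open Scope ring_scope.

(* U (x) V is modelled by the coordinates of a tensor on the basis
   e_i (x) f_j, where e = vbasis {:U} and f = vbasis {:V}. The type is an alias
   that only carries a vector space structure: the product of matrices is not
   the product of H (x) H. *)
Definition tensor (K : fieldType) (U V : vectType K) : Type :=
  'M[K]_(\dim {:U}, \dim {:V}).

HB.instance Definition _ (K : fieldType) (U V : vectType K) :=
  Vector.copy (tensor U V) 'M[K]_(\dim {:U}, \dim {:V}).

Section Tensor.
Context {K : fieldType}.
Implicit Types U V W : vectType K.

Definition tens U V (u : U) (v : V) : tensor U V :=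
  \matrix_(i, j) (coord (vbasis {:U}) i u * coord (vbasis {:V}) j v).

(* The linear map U (x) V -> W induced by a bilinear map f; in Sweedler
   notation, tlift f (Delta h) is f(h_(1), h_(2)). *)
Definition tlift U V W (f : U -> V -> W) (t : tensor U V) : W :=
  \sum_(i < \dim {:U}) \sum_(j < \dim {:V})
     (t : 'M[K]_(\dim {:U}, \dim {:V})) i j
       *: f (vbasis {:U})`_i (vbasis {:V})`_j.

Lemma tlift_is_linear U V W (f : U -> V -> W) : linear (tlift f).
Proof.
move=> a s t; rewrite /tlift scaler_sumr -big_split; apply: eq_bigr => i _.
rewrite scaler_sumr -big_split; apply: eq_bigr => j _.
by rewrite !mxE scalerDl scalerA.
Qed.

HB.instance Definition _ U V W (f : U -> V -> W) :=
  GRing.isLinear.Build K (tensor U V) W *:%R (tlift f) (tlift_is_linear f).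

Lemma tlift_tens U V W (f : U -> V -> W) :
  (forall v, linear (f^~ v)) -> (forall u, linear (f u)) ->
  forall u v, tlift f (tens u v) = f u v.
Proof.
move=> linl linr u v.
pose Fl y := GRing.isLinear.Build K U W *:%R (f^~ y) (linl y).
pose Fr x := GRing.isLinear.Build K V W *:%R (f x) (linr x).
pose fl y : {linear U -> W} := HB.pack (f^~ y) (Fl y).
pose fr x : {linear V -> W} := HB.pack (f x) (Fr x).
transitivity (fl v u) => //.
rewrite [in RHS](coord_vbasis (memvf u)) linear_sum; apply: eq_bigr => i _.
rewrite linearZ /=.
transitivity (coord (vbasis {:U}) i u *: fr (vbasis {:U})`_i v) => //.
rewrite [in RHS](coord_vbasis (memvf v)) linear_sum scaler_sumr.
by apply: eq_bigr => j _; rewrite linearZ /= mxE scalerA.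
Qed.

Definition tmap U V U' V' (f : U -> U') (g : V -> V') :
    tensor U V -> tensor U' V' :=
  tlift (fun u v => tens (f u) (g v)).

Definition tassoc U V W : tensor (tensor U V) W -> tensor U (tensor V W) :=
  tlift (fun t w => tlift (fun u v => tens u (tens v w)) t).

Definition tmul (A B : falgType K) (s t : tensor A B) : tensor A B :=
  tlift (fun a b => tlift (fun a' b' => tens (a * a') (b * b')) t) s.

End Tensor.

HB.mixin Record isHopf (K : fieldType) H of Falgebra K H := {
  coprod : {linear H -> tensor H H};
  counit : {lrmorphism H -> K | *%R};
  antipode : {linear H -> H};
  coprodA : forall h,
    tassoc (tmap coprod idfun (coprod h)) = tmap idfun coprod (coprod h);
  counitl : forall h, tlift (fun a b => counit a *: b) (coprod h) = h;
  counitr : forall h, tlift (fun a b => counit b *: a) (coprod h) = h;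
  coprod1 : coprod 1 = tens 1 1;
  coprodM : forall g h, coprod (g * h) = tmul (coprod g) (coprod h);
  antipodel : forall h,
    tlift (fun a b => antipode a * b) (coprod h) = (counit h)%:A;
  antipoder : forall h,
    tlift (fun a b => a * antipode b) (coprod h) = (counit h)%:A
}.

#[short(type="hopfAlgType")]
HB.structure Definition HopfAlgebra (K : fieldType) :=
  { H of isHopf K H & Falgebra K H }.

Section Hopf.
Context {K : fieldType}.
Implicit Type H : hopfAlgType K.

Definition left_ideal H (I : {vspace H}) : Prop :=
  forall h x, x \in I -> h * x \in I.

(* The left regular module is semisimple: every submodule has a complement. *)
Definition semisimple H : Prop :=
  forall I : {vspace H}, left_ideal I ->
  exists J : {vspace H},
    [/\ left_ideal J, (I + J = fullv)%VS & (I :&: J = 0)%VS].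

Definition normalized_integral H (L : H) : Prop :=
  [/\ forall h, h * L = counit h *: L,
      forall h, L * h = counit h *: L
    & counit L = 1].

(* tpow H n is the (n+1)-st tensor power H (x) (H (x) (... (x) H)). *)
Fixpoint tpow H (n : nat) : vectType K :=
  if n is n'.+1 then tensor H (tpow H n') else H.

(* h |-> h_(1) (x) ... (x) h_(n+1) *)
Fixpoint iter_coprod H (n : nat) : H -> tpow H n :=
  match n return H -> tpow H n with
  | 0 => idfun
  | n'.+1 => fun h => tmap idfun (@iter_coprod H n') (coprod h)
  end.

(* x_1 (x) ... (x) x_(n+1) |-> x_1 ... x_(n+1) *)
Fixpoint iter_mul H (n : nat) : tpow H n -> H :=
  match n return tpow H n -> H with
  | 0 => idfun
  | n'.+1 => tlift (fun (a : H) (t : tpow H n') => a * iter_mul t)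
  end.

(* h^[m] = h_(1) ... h_(m); only meaningful for m >= 1. *)
Definition sweedler_power H (m : nat) (h : H) : H :=
  iter_mul (iter_coprod m.-1 h).

End Hopf.

Record hmodule (K : fieldType) (H : hopfAlgType K) := HModule {
  hmodule_sort :> vectType K;
  haction : {linear H -> 'End(hmodule_sort)};
  haction1 : haction 1 = \1%VF;
  hactionM : forall g h, haction (g * h) = (haction g \o haction h)%VF
}.

Section Modules.
Context {K : fieldType} {H : hopfAlgType K}.
Implicit Type V : hmodule H.

Definition lfun_trace (V : vectType K) (f : 'End(V)) : K :=
  \tr (passmx.mxof (vbasis {:V}) (vbasis {:V}) f).

Definition character V (h : H) : K := lfun_trace (haction V h).

Definition FS_indicator (L : H) (m : nat) (chi : H -> K) : K :=
  chi (sweedler_power m L).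

Definition trivial_power V (d : nat) : Prop :=
  forall (h : H) (v : V), haction V (sweedler_power d h) v = counit h *: v.

Definition has_exponent V (d : nat) : Prop :=
  [/\ (0 < d)%N, trivial_power V d
    & forall e, (0 < e)%N -> trivial_power V e -> (d <= e)%N].

End Modules.

Definition large_compared_to (m d : nat) : Prop :=
  forall p k q : nat, prime p -> (p %| d)%N -> (p %| m)%N ->
    d = (p ^ k * q)%N -> ~~ (p %| q)%N -> (p ^ k %| m)%N.

Definition squarefree (d : nat) : Prop :=
  forall n : nat, (n ^ 2 %| d)%N -> n = 1%N.

(* Main.v *)
Require Import Defs.
From HB Require Import structures.
From mathcomp Require Import all_boot all_order all_algebra all_field cyclic.

(** Write X for the matrix of the functionals h |-> (h.v_j)_i on H, a matrix over
    the convolution algebra H^*. Then chi(h^[m]) = tr(X^m)(h), and X^d = 1. Two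
    trace formulas locate nu_m(chi) = tr(X^m)(Lambda) in cyclotomic fields.

    First, nu_m(chi) is the trace, on the m-th tensor power of V, of the action of
    Lambda followed by the cyclic shift. As Lambda is cocommutative, the two commute,
    so this operator A satisfies A^(m+1) = A, and nu_m(chi) is a sum of m-th roots of
    unity. Second, (dim H) Lambda is the character of the regular representation of
    H^*, so (dim H) nu_m(chi) is the trace of T^m, where T(h (x) v) = h_(1) (x) h_(2) v
    on H (x) V. Since T^d = 1, this is a sum of e-th roots of unity, e = d / gcd(m, d).
    If m is large compared to d, then m and e are coprime, so the sum of m-th roots
    of unity is rational and hence an integer. If d is squarefree, every m is large.

    Both facts about Lambda come from the Larson-Radford theorem. The functional
    lambda(h) = tr(x |-> h S^2(x)) is an integral of H^*, and H is a Frobenius algebra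
    with Nakayama automorphism S^2. Comparing left and right integrals, S^4 is
    conjugation by a group-like element, so S^2 has finite order. By semisimplicity,
    S^2 is also conjugation by some w, a power of which is central. Splitting H along
    the eigenspaces of that power writes lambda(1) = tr(S^2) as a nonempty sum of
    terms |t|^2 / k with t a nonzero sum of roots of unity and k > 0, so it does not
    vanish. Therefore H^* is unimodular and S^4 = 1. Finally, the regular character t
    of H^* satisfies t^2 = n t with n = dim H, and tr(S^2) is n times the trace of S^2
    on the image of the idempotent t / n. As S^4 = 1 both traces are integers, and
    |tr(S^2)| <= n, which forces S^2 = 1 and then t / n = Lambda. *)

Set Implicit Arguments.
Unset Strict Implicit.
Unset Printing Implicit Defensive.

Import GRing.Theory.
Local Open Scope ring_scope.

(** * Linear maps and Sweedler sums *)

Section Lin.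
Variable K : fieldType.
Implicit Types U V W X : vectType K.

(** A predicate on bare functions, so that maps written with nested Sweedler sums are shown linear
    by a tactic and need no structure of their own. *)
Definition lin U V (f : U -> V) := forall (a : K) x y, f (a *: x + y) = a *: f x + f y.

Definition pack_lin U V (f : U -> V) (lf : lin f) : {linear U -> V} :=
  HB.pack f (GRing.isLinear.Build K U V *:%R f lf).

Lemma lin_linear U V (f : {linear U -> V}) : lin f.
Proof. by move=> a x y; rewrite linearP. Qed.

Lemma lin_sum U V (f : U -> V) : lin f -> forall I (r : seq I) (P : pred I) F,
  f (\sum_(i <- r | P i) F i) = \sum_(i <- r | P i) f (F i).
Proof. move=> lf I r P F; exact: (linear_sum (pack_lin lf)). Qed.

Lemma linZ U V (f : U -> V) : lin f -> forall a x, f (a *: x) = a *: f x.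
Proof. move=> lf a x; exact: (linearZZ (pack_lin lf)). Qed.

Lemma lin_id V : lin (fun x : V => x). Proof. by []. Qed.
Lemma lin_app U V W (f : {linear V -> W}) (g : U -> V) : lin g -> lin (fun x => f (g x)).
Proof. by move=> lg a x y; rewrite lg linearP. Qed.
Lemma lin_comp U V W (f : V -> W) (g : U -> V) : lin f -> lin g -> lin (fun x => f (g x)).
Proof. by move=> lf lg a x y; rewrite lg lf. Qed.
Lemma lin_scaler U V k (g : U -> V) : lin g -> lin (fun x => k *: g x).
Proof. by move=> lg a x y; rewrite lg scalerDr !scalerA mulrC. Qed.
Lemma lin_scalel U V (g : U -> K^o) (v : V) : lin g -> lin (fun x => (g x : K) *: v).
Proof. by move=> lg a x y; rewrite lg scalerDl scalerA. Qed.
Lemma lin_tlift U V W X (F : U -> V -> X -> W) t :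
  (forall u v, lin (F u v)) -> lin (fun x => tlift (fun u v => F u v x) t).
Proof.
move=> lF a x y; rewrite /tlift scaler_sumr -big_split; apply: eq_bigr => i _.
rewrite scaler_sumr -big_split; apply: eq_bigr => j _.
by rewrite lF /= scalerDr !scalerA mulrC.
Qed.
Lemma lin_tensl U V W (f : W -> U) (v : V) : lin f -> lin (fun x => tens (f x) v).
Proof.
move=> lf a x y; apply/matrixP=> i j; rewrite lf !mxE linearP /= mulrDl.
by rewrite mulrA.
Qed.
Lemma lin_tensr U V W (f : W -> V) (u : U) : lin f -> lin (fun x => tens u (f x)).
Proof.
move=> lf a x y; apply/matrixP=> i j; rewrite lf !mxE linearP /= mulrDr.
by congr (_ + _); rewrite mulrCA.
Qed.
End Lin.

Section LinAlg.
Variables (K : fieldType) (U : vectType K) (A : falgType K).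
Lemma lin_mull (f : U -> A) a : lin f -> lin (fun x => f x * a).
Proof. by move=> lf k x y; rewrite lf mulrDl scalerAl. Qed.
Lemma lin_mulr (f : U -> A) a : lin f -> lin (fun x => a * f x).
Proof. by move=> lf k x y; rewrite lf mulrDr scalerAr. Qed.
Lemma lin_smull (f : U -> K^o) (a : K) : lin f -> lin (fun x => (f x : K) * a : K^o).
Proof. by move=> lf k x y; rewrite lf mulrDl /GRing.scale /= mulrA. Qed.
Lemma lin_smulr (f : U -> K^o) (a : K) : lin f -> lin (fun x => a * (f x : K) : K^o).
Proof. by move=> lf k x y; rewrite lf mulrDr /GRing.scale /= mulrCA. Qed.
End LinAlg.

Section SweedlerSum.
Variables (K : fieldType) (H : hopfAlgType K).

(* [Sw (fun a b => F a b) h] is [F(h_(1), h_(2))]. *)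
Definition Sw (W : vectType K) (F : H -> H -> W) h := tlift F (coprod h).

Lemma Sw_lin (W : vectType K) (F : H -> H -> W) : lin (Sw F).
Proof. by move=> a x y; rewrite /Sw !linearP. Qed.

Lemma lin_Sw1 (U W : vectType K) (F : H -> H -> W) (f : U -> H) : lin f -> lin (fun x => Sw F (f x)).
Proof. by move=> lf a x y; rewrite lf Sw_lin. Qed.

Lemma lin_Sw2 (U W : vectType K) (F : H -> H -> U -> W) h :
  (forall u v, lin (F u v)) -> lin (fun x => Sw (fun a b => F a b x) h).
Proof. by move=> lF; apply: lin_tlift. Qed.

Lemma lin_counit (U : vectType K) (f : U -> H) : lin f -> lin (fun x => counit (f x) : K^o).
Proof. by move=> lf a x y; rewrite lf linearP. Qed.
End SweedlerSum.

(* [solve_lin] proves [lin (fun x => E)] when [x] occurs exactly once in [E]. *)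
Ltac linstep :=
  match goal with
  | |- forall _, _ => intro
  | |- lin (tlift ?F) => exact (@lin_linear _ _ _ (tlift F))
  | |- lin (Sw ?F) => exact (@Sw_lin _ _ _ F)
  | |- lin (fun x => x) => exact (@lin_id _ _)
  | |- lin (fun x => tens (@?f x) ?v) => refine (@lin_tensl _ _ _ _ f v _)
  | |- lin (fun x => tens ?v (@?f x)) => refine (@lin_tensr _ _ _ _ f v _)
  | |- lin (fun x => Sw ?F (@?f x)) => refine (@lin_Sw1 _ _ _ _ F f _)
  | |- lin (fun x => Sw (@?F x) ?h) => refine (@lin_Sw2 _ _ _ _ (fun a b x => F x a b) h _)
  | |- lin (fun x => tlift ?F (@?f x)) => refine (@lin_app _ _ _ _ (tlift F) f _)
  | |- lin (fun x => tlift (@?F x) ?h) => refine (@lin_tlift _ _ _ _ _ (fun a b x => F x a b) h _)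
  | |- lin (fun x => _ (@?f x)) => refine (@lin_counit _ _ _ f _)
  | |- lin (fun x => ?k *: (@?f x)) => refine (@lin_scaler _ _ _ k f _)
  | |- lin (fun x => (@?f x) *: ?v) => refine (@lin_scalel _ _ _ f v _)
  | |- lin (fun x => @GRing.mul _ ?k (@?f x)) => first [refine (@lin_mulr _ _ _ f k _) | refine (@lin_smulr _ _ f k _)]
  | |- lin (fun x => @GRing.mul _ (@?f x) ?k) => first [refine (@lin_mull _ _ _ f k _) | refine (@lin_smull _ _ f k _)]
  | H : lin ?g |- lin (fun x => ?g (@?f x)) => refine (@lin_comp _ _ _ _ _ f H _)
  | |- lin (fun x => ?g (@?f x)) => refine (@lin_app _ _ _ _ g f _)
  | H : _ |- lin _ => exact: H
  | H : _ |- lin (fun x => ?g (@?f x)) => refine (@lin_comp _ _ _ _ g f _ _); [exact: H|]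
  | H : _ |- lin (fun x => ?g (@?f x) ?a) => refine (@lin_comp _ _ _ _ (fun y => g y a) f _ _); [exact: H|]
  | H : _ |- lin (fun x => ?g (@?f x) ?a ?b) => refine (@lin_comp _ _ _ _ (fun y => g y a b) f _ _); [exact: H|]
  end.
Ltac solve_lin := cbv beta; repeat (linstep; cbv beta).

Section SweedlerRules.
Variables (K : fieldType) (H : hopfAlgType K).
Implicit Types (W X : vectType K) (h g : H).

Definition bil (U V W : vectType K) (F : U -> V -> W) := (forall v, lin (F^~ v)) /\ (forall u, lin (F u)).

Lemma tliftE (U V W : vectType K) (F : U -> V -> W) u v : bil F -> tlift F (tens u v) = F u v.
Proof. by case=> l1 l2; apply: tlift_tens => [v' a x y|u' a x y]; [apply: l1|apply: l2]. Qed.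

Lemma lin_tlift_sum (U V : vectType K) W X (G : W -> X) (F : U -> V -> W) t :
  lin G -> G (tlift F t) = tlift (fun a b => G (F a b)) t.
Proof.
move=> lG; rewrite /tlift (lin_sum lG); apply: eq_bigr => i _.
by rewrite (lin_sum lG); apply: eq_bigr => j _; rewrite (linZ lG).
Qed.

Lemma eq_Sw W (F G : H -> H -> W) h : (forall a b, F a b = G a b) -> Sw F h = Sw G h.
Proof. by move=> e; rewrite /Sw /tlift; apply: eq_bigr => i _; apply: eq_bigr=> j _; rewrite e. Qed.

Lemma Sw_push W X (G : W -> X) (F : H -> H -> W) h :
  lin G -> G (Sw F h) = Sw (fun a b => G (F a b)) h.
Proof. exact: lin_tlift_sum. Qed.

Lemma Sw_exch W (F : H -> H -> H -> H -> W) g h :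
  Sw (fun a b => Sw (F a b) h) g = Sw (fun c d => Sw (fun a b => F a b c d) g) h.
Proof.
rewrite /Sw /tlift.
under eq_bigr => i _ do under eq_bigr => j _ do rewrite scaler_sumr.
under eq_bigr => i _ do rewrite exchange_big.
rewrite exchange_big; apply: eq_bigr => k _ /=.
under eq_bigr => i _ do under eq_bigr => j _ do rewrite scaler_sumr.
under eq_bigr => i _ do rewrite exchange_big.
rewrite exchange_big; apply: eq_bigr => l _ /=.
rewrite scaler_sumr; apply: eq_bigr => i _.
rewrite scaler_sumr; apply: eq_bigr => j _.
by rewrite !scalerA mulrC.
Qed.

Lemma Sw_tmap W (U V : vectType K) (f : H -> U) (g : H -> V) (F : U -> V -> W) h :
  bil F -> tlift F (tmap f g (coprod h)) = Sw (fun a b => F (f a) (g b)) h.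
Proof.
move=> bF; rewrite /tmap lin_tlift_sum; last exact: lin_linear.
by apply: eq_Sw => a b; rewrite tliftE.
Qed.

(** Both sides are the trilinear [F], lifted to the threefold tensor product, at the two sides of
    [coprodA]. *)
Lemma SwA W (F : H -> H -> H -> W) h :
  (forall b c, lin (fun a => F a b c)) -> (forall a c, lin (fun b => F a b c)) ->
  (forall a b, lin (F a b)) ->
  Sw (fun a b => Sw (fun c d => F c d b) a) h = Sw (fun a b => Sw (fun c d => F a c d) b) h.
Proof.
move=> l1 l2 l3.
pose G := fun (a : H) (t : tensor H H) => tlift (fun b c => F a b c) t.
have bG : bil G by split; rewrite /G; solve_lin.
have := congr1 (tlift G) (coprodA h).
rewrite [in RHS]Sw_tmap //= => e; transitivity (tlift G (tmap idfun coprod (coprod h))); last by rewrite Sw_tmap.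
rewrite -coprodA /tassoc. rewrite [X in _ = X]lin_tlift_sum; last exact: lin_linear.
rewrite Sw_tmap; last by split; solve_lin.
apply: eq_Sw => a b /=. rewrite /Sw [in RHS]lin_tlift_sum; last exact: lin_linear.
apply: eq_Sw => c d /=. rewrite tliftE // /G tliftE //.
Qed.
End SweedlerRules.

(** * The antipode reverses products and coproducts *)

Section Antipode.
Variables (K : fieldType) (H : hopfAlgType K).
Implicit Types (W X : vectType K) (h g : H).
Local Notation S := (@antipode K H).

Lemma SwM W (F : H -> H -> W) g h : bil F ->
  Sw F (g * h) = Sw (fun a b => Sw (fun c d => F (a * c) (b * d)) h) g.
Proof.
move=> [l1 l2]; rewrite /Sw coprodM /tmul lin_tlift_sum; last exact: lin_linear.
apply: eq_Sw => a b; rewrite lin_tlift_sum; last exact: lin_linear.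
by apply: eq_Sw => c d; rewrite tliftE.
Qed.

Lemma Sw1 W (F : H -> H -> W) : bil F -> Sw F 1 = F 1 1.
Proof. by move=> bF; rewrite /Sw coprod1 tliftE. Qed.

Lemma Sw_counitl W (F : H -> W) h : lin F -> Sw (fun a b => counit a *: F b) h = F h.
Proof.
move=> lF; rewrite -[in RHS](counitl h) lin_tlift_sum //.
by apply: eq_Sw => a b; rewrite (linZ lF).
Qed.

Lemma Sw_counitr W (F : H -> W) h : lin F -> Sw (fun a b => counit b *: F a) h = F h.
Proof.
move=> lF; rewrite -[in RHS](counitr h) lin_tlift_sum //.
by apply: eq_Sw => a b; rewrite (linZ lF).
Qed.

Lemma Sw_antipodel W (F : H -> W) h : lin F -> Sw (fun a b => F (S a * b)) h = counit h *: F 1.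
Proof. by move=> lF; rewrite -(linZ lF) -(antipodel h) lin_tlift_sum. Qed.

Lemma Sw_antipoder W (F : H -> W) h : lin F -> Sw (fun a b => F (a * S b)) h = counit h *: F 1.
Proof. by move=> lF; rewrite -(linZ lF) -(antipoder h) lin_tlift_sum. Qed.

Lemma SwZ W (k : K) (F : H -> H -> W) h : Sw (fun a b => k *: F a b) h = k *: Sw F h.
Proof. rewrite Sw_push //; exact: lin_scaler. Qed.

Lemma counitMs g h : counit (g * h) = counit g * counit h.
Proof. by rewrite rmorphM. Qed.

(* Both sides are [S(g_1 h_1) g_2 h_2 S(h_3) S(g_3)]. *)
Lemma antipodeM g h : S (g * h) = S h * S g.
Proof.
pose Q := Sw (fun a b => Sw (fun c d => Sw (fun a1 a2 => Sw (fun c1 c2 =>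
  S (a1 * c1) * (a2 * c2) * (S d * S b)) c) a) h) g.
transitivity Q; rewrite /Q.
- transitivity (Sw (fun a b => Sw (fun c d => counit d *: (counit b *: S (a * c))) h) g).
    under eq_Sw => a b.
      rewrite (@Sw_counitr _ (fun c => counit b *: S (a * c))); last by solve_lin.
      over.
    by rewrite (@Sw_counitr _ (fun a => S (a * h))); last by solve_lin.
  symmetry.
  under eq_Sw => a b do rewrite Sw_exch.
  rewrite (@SwA _ _ _ (fun a1 a2 b => Sw (fun c d => Sw (fun c1 c2 =>
        S (a1 * c1) * (a2 * c2) * (S d * S b)) c) h)); try by solve_lin.
  apply: eq_Sw => a b.
  transitivity (Sw (fun b1 b2 => Sw (fun c d => counit d *: (S (a * c) * b1 * S b2)) h) b).
    apply: eq_Sw => b1 b2.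
    rewrite (@SwA _ _ _ (fun c1 c2 d => S (a * c1) * (b1 * c2) * (S d * S b2))); try by solve_lin.
    apply: eq_Sw => c d.
    rewrite -[S (a * c) * b1 in RHS]mulr1 -(@Sw_antipoder _ (fun x => S (a * c) * b1 * x * S b2));
  last by solve_lin.
    by apply: eq_Sw => d1 d2; rewrite !mulrA.
  rewrite Sw_exch; apply: eq_Sw => c d; rewrite SwZ; congr (_ *: _).
  rewrite -[X in _ = _ *: X]mulr1 -(@Sw_antipoder _ (fun x => S (a * c) * x)); last by solve_lin.
  by apply: eq_Sw => b1 b2; rewrite !mulrA.
(* Here [S(a_1 c_1) a_2 c_2] is read as a Sweedler sum of the product [a c], to which the antipode
   axiom applies. *)
- transitivity (Sw (fun a b => Sw (fun c d => counit (a * c) *: (S d * S b)) h) g).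
    apply: eq_Sw => a b; apply: eq_Sw => c d.
    transitivity (Sw (fun x y => S x * y * (S d * S b)) (a * c)).
      by rewrite SwM //; split; solve_lin.
    by rewrite (@Sw_antipodel _ (fun x => x * (S d * S b))) ?mul1r; last by solve_lin.
  under eq_Sw => a b.
    under eq_Sw => c d do rewrite counitMs mulrC -scalerA.
    rewrite (@Sw_counitl _ (fun d => counit a *: (S d * S b))); last by solve_lin.
    over.
  by rewrite (@Sw_counitl _ (fun b => S h * S b)); last by solve_lin.
Qed.

Lemma antipode1 : S 1 = 1.
Proof.
have := @Sw_antipodel H idfun 1 (@lin_id _ H).
by rewrite Sw1; [rewrite /= mulr1 => ->; rewrite rmorph1 scale1r|split; rewrite /=; solve_lin].
Qed.

(* [Delta(S(h_1)) Delta(h_2) (S(h_4) (x) S(h_3))], contracted in two ways. *)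
Lemma Sw_antipode W (F : H -> H -> W) h : bil F ->
  Sw F (S h) = Sw (fun a b => F (S b) (S a)) h.
Proof.
move=> [l1 l2].
pose Q := Sw (fun a b => Sw (fun a1 a2 => Sw (fun p q => Sw (fun r s => Sw (fun c d =>
   F (p * r * S d) (q * s * S c)) b) a2) (S a1)) a) h.
transitivity Q; rewrite /Q.
- rewrite (@SwA _ _ _ (fun a1 a2 b => Sw (fun p q => Sw (fun r s => Sw (fun c d =>
   F (p * r * S d) (q * s * S c)) b) a2) (S a1))); try by solve_lin.
  rewrite -{1}(@Sw_counitr _ (fun x => Sw F (S x))); last by solve_lin.
  apply: eq_Sw => a b; rewrite Sw_exch -SwZ; apply: eq_Sw => p q.
  symmetry.
  rewrite (@SwA _ _ _ (fun r s b2 => Sw (fun c d => F (p * r * S d) (q * s * S c)) b2)); try by solve_lin.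
  transitivity (Sw (fun r b2 => F (p * r * S b2) q) b); last first.
    by rewrite -{2}[p]mulr1 -(@Sw_antipoder _ (fun x => F (p * x) q));
      [apply: eq_Sw => r t; rewrite mulrA | solve_lin].
  apply: eq_Sw => r t.
  rewrite -(@SwA _ _ _ (fun s c d => F (p * r * S d) (q * s * S c))); try by solve_lin.
  rewrite -(@Sw_counitl _ (fun d => F (p * r * S d) q)); last by solve_lin.
  apply: eq_Sw => s d.
  rewrite -{2}[q]mulr1 -(@Sw_antipoder _ (fun x => F (p * r * S d) (q * x))); last by solve_lin.
  by apply: eq_Sw => x y; rewrite mulrA.
- transitivity (Sw (fun a b => Sw (fun a1 a2 => Sw (fun x y => Sw (fun c d => F (x * S d) (y * S c)) b) (S a1 * a2)) a) h).
    by apply: eq_Sw => a b; apply: eq_Sw => a1 a2; rewrite SwM //; split; solve_lin.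
  rewrite -(@Sw_counitl _ (fun b => Sw (fun c d => F (S d) (S c)) b)); last by solve_lin.
  apply: eq_Sw => a b.
  rewrite (@Sw_antipodel _ (fun z => Sw (fun x y => Sw (fun c d => F (x * S d) (y * S c)) b) z));
  last by solve_lin.
  rewrite Sw1; last by split; solve_lin.
  by congr (_ *: _); apply: eq_Sw => c d; rewrite !mul1r.
Qed.

(** Both are the counit of [h_1 S(h_2)]. *)
Lemma counit_antipode h : counit (S h) = counit h.
Proof.
have lc : lin (fun x : H => counit x : K^o) by exact: (lin_counit (@lin_id _ _)).
transitivity (Sw (fun a b => counit a *: (counit (S b) : K^o)) h).
  by rewrite (@Sw_counitl K^o (fun b => counit (S b))) //; solve_lin.
transitivity (Sw (fun a b => (counit (a * S b) : K^o)) h).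
  by apply: (@eq_Sw _ _ K^o) => a b; rewrite counitMs.
rewrite (@Sw_antipoder K^o (fun x => counit x)) //.
by rewrite rmorph1 /GRing.scale /= mulr1.
Qed.

End Antipode.

(** * Traces of linear endomorphisms *)

Section Trace.
Variable K : fieldType.
Implicit Types U V W : vectType K.

Definition ltrace V (f : V -> V) : K :=
  \sum_i coord (vbasis {:V}) i (f (vbasis {:V})`_i).

Lemma eq_ltrace V (f g : V -> V) : (forall x, f x = g x) -> ltrace f = ltrace g.
Proof. by move=> e; apply: eq_bigr => i _; rewrite e. Qed.

Lemma basisE V (v : V) : v = \sum_i coord (vbasis {:V}) i v *: (vbasis {:V})`_i.
Proof. exact: (coord_vbasis (memvf v)). Qed.

Lemma ltraceC U V (f : U -> V) (g : V -> U) : lin f -> lin g ->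
  ltrace (fun x => g (f x)) = ltrace (fun y => f (g y)).
Proof.
move=> lf lg; rewrite /ltrace.
under eq_bigr => i _.
  rewrite (basisE (f _)) (lin_sum lg) linear_sum /=.
  under eq_bigr => j _ do rewrite (linZ lg) linearZ /=.
  over.
rewrite exchange_big /=; apply: eq_bigr => j _.
rewrite [in RHS](basisE (g _)) (lin_sum lf) linear_sum /=.
by apply: eq_bigr => i _; rewrite (linZ lf) linearZ /= mulrC.
Qed.

Lemma ltrace_sum V I (r : seq I) (P : pred I) (F : I -> V -> V) :
  ltrace (fun x => \sum_(i <- r | P i) F i x) = \sum_(i <- r | P i) ltrace (F i).
Proof.
rewrite /ltrace exchange_big; apply: eq_bigr => i _; exact: linear_sum.
Qed.

Lemma ltraceZ V k (f : V -> V) : ltrace (fun x => k *: f x) = k * ltrace f.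
Proof. by rewrite /ltrace mulr_sumr; apply: eq_bigr => i _; rewrite linearZ. Qed.

Lemma ltraceB V (f g : V -> V) : ltrace (fun x => f x - g x) = ltrace f - ltrace g.
Proof. by rewrite /ltrace -sumrB; apply: eq_bigr => i _; rewrite linearB. Qed.

Lemma ltrace_rank1 V (l : V -> K^o) v : lin l -> ltrace (fun x => l x *: v) = l v.
Proof.
move=> ll; rewrite [in RHS](basisE v) (lin_sum ll) /ltrace; apply: eq_bigr => i _.
by rewrite linearZ (linZ ll) /= mulrC.
Qed.

Lemma coordP V (u v : V) : (forall i, coord (vbasis {:V}) i u = coord (vbasis {:V}) i v) -> u = v.
Proof. by move=> e; rewrite (basisE u) (basisE v); apply: eq_bigr => i _; rewrite e. Qed.

Lemma lin_coord V n (X : n.-tuple V) i : lin (coord X i : V -> K^o).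
Proof. by move=> a x y; rewrite linearP. Qed.

Lemma lin_ltrace U V (F : U -> V -> V) : (forall x, lin (F^~ x)) -> lin (fun u => ltrace (F u) : K^o).
Proof.
move=> lF a x y; rewrite /ltrace scaler_sumr -big_split; apply: eq_bigr => i _.
by rewrite lF linearP.
Qed.

Lemma lin_bigsum U V I (r : seq I) (P : pred I) (F : I -> U -> V) :
  (forall i, lin (F i)) -> lin (fun x => \sum_(i <- r | P i) F i x).
Proof.
move=> lF a x y; rewrite scaler_sumr -big_split; apply: eq_bigr => i _; exact: lF.
Qed.
End Trace.

(** * Integrals of the dual *)

Section DualIntegral.
Variables (K : fieldType) (H : hopfAlgType K).
Implicit Types (W X : vectType K) (h g : H).
Local Notation S := (@antipode K H).
Local Notation e_ := (vbasis {:H}).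

(** The legs of the coproduct along the basis: [Delta(h)] is the sum over [k] of
    [e_k (x) legl k h]. *)
Definition legl (k : 'I_(\dim {:H})) h := Sw (fun a b : H => (coord e_ k a) *: b) h.

Lemma lin_legl k : lin (legl k).
Proof. exact: Sw_lin. Qed.

Lemma Sw_sum W I (r : seq I) (P : pred I) (F : I -> H -> H -> W) h :
  Sw (fun a b => \sum_(i <- r | P i) F i a b) h = \sum_(i <- r | P i) Sw (F i) h.
Proof.
rewrite /Sw /tlift [RHS]exchange_big; apply: eq_bigr => i _.
by rewrite [RHS]exchange_big; apply: eq_bigr => j _; rewrite scaler_sumr.
Qed.

Lemma Sw_legl W (F : H -> H -> W) h : bil F ->
  Sw F h = \sum_(k < \dim {:H}) F e_`_k (legl k h).
Proof.
move=> [l1 l2]; rewrite /legl.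
under [RHS]eq_bigr => k _ do rewrite Sw_push //.
rewrite -Sw_sum; apply: eq_Sw => a b; rewrite {1}(basisE a) (lin_sum (l1 b)).
by apply: eq_bigr => k _; rewrite (linZ (l1 b)) (linZ (l2 _)).
Qed.

(* The twist by [S^2] makes this trace an integral of the dual, which spares the
   general existence theorem for integrals. *)
Definition lambda h : K := ltrace (fun x => h * S (S x)).

Lemma lin_lambda : lin (lambda : H -> K^o).
Proof. by apply: lin_ltrace => x; solve_lin. Qed.

(* [h_1 (x) h_2 S^2(x) = h_1 S^2(x_2) S(x_1) (x) h_2 S^2(x_3)] *)
Lemma lambda_twist (f : H -> K^o) h x : lin f ->
  Sw (fun a b => (f a : K) *: (b * S (S x))) h =
  Sw (fun x1 x2 => Sw (fun p q => (f (p * S x1) : K) *: q) (h * S (S x2))) x.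
Proof.
move=> lf; symmetry.
transitivity (Sw (fun x1 x2 => Sw (fun c d => Sw (fun a b =>
    (f (a * S (S c) * S x1) : K) *: (b * S (S d))) h) x2) x).
  apply: eq_Sw => x1 x2; rewrite SwM; last by split; solve_lin.
  rewrite [RHS]Sw_exch; apply: eq_Sw => a b.
  rewrite Sw_antipode; last by split; solve_lin.
  by rewrite Sw_antipode; last by split; solve_lin.
rewrite -(@SwA _ _ _ (fun x1 c d => Sw (fun a b =>
    (f (a * S (S c) * S x1) : K) *: (b * S (S d))) h)); try by solve_lin.
rewrite -(@Sw_counitl _ _ _ (fun d => Sw (fun a b => (f a : K) *: (b * S (S d))) h));
  last by solve_lin.
apply: eq_Sw => y d; rewrite Sw_exch -SwZ; apply: eq_Sw => a b.
rewrite -{2}[a]mulr1 -[in RHS]antipode1.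
rewrite -(@Sw_antipoder _ _ _ (fun z => (f (a * S z) : K) *: (b * S (S d)))); last by solve_lin.
by apply: eq_Sw => x1 c; rewrite antipodeM mulrA.
Qed.

(* After [lambda_twist], cyclicity of the trace moves [x_1] next to the leg it cancels. *)
Lemma lambda_left_integral h : Sw (fun a b => lambda b *: a) h = lambda h *: 1.
Proof.
apply: coordP => j; pose f : H -> K^o := coord e_ j.
have lf : lin f by exact: lin_coord.
rewrite -/(f _) -/(f _) Sw_push // (linZ lf).
have -> : Sw (fun a b => f (lambda b *: a)) h = ltrace (fun x => Sw (fun a b => (f a : K) *: (b * S (S x))) h).
  rewrite /ltrace; under [RHS]eq_bigr => i _.
    rewrite (Sw_push _ _ (@lin_coord _ _ _ e_ i)).
    over.
  rewrite -(@Sw_sum K^o); apply: (@eq_Sw _ _ K^o) => a b.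
  rewrite (linZ lf) /lambda /ltrace scaler_suml; apply: eq_bigr => i _.
  by rewrite linearZ /= mulrC.
pose P (k : 'I_(\dim {:H})) z := Sw (fun p q => (f (p * S e_`_k) : K) *: q) z.
have lP k : lin (P k) by rewrite /P; solve_lin.
transitivity (ltrace (fun x => \sum_(k < \dim {:H}) P k (h * S (S (legl k x))))).
  apply: eq_ltrace => x; rewrite lambda_twist //.
  by rewrite (@Sw_legl _ (fun x1 x2 => Sw (fun p q => (f (p * S x1) : K) *: q) (h * S (S x2)))) //; split; solve_lin.
rewrite ltrace_sum.
under eq_bigr => k _.
  rewrite (@ltraceC _ _ _ (fun x => h * S (S (legl k x))) (P k)); last 2 first.
  - by have := lin_legl k; solve_lin.
  - exact: lP.
  over.
transitivity ((f 1 : K) * lambda h : K); last exact: mulrC.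
rewrite -ltrace_sum /= /lambda -(@ltraceZ K); apply: eq_ltrace => z.
transitivity (h * S (S (\sum_(k < \dim {:H}) legl k (P k z)))).
  by rewrite !linear_sum mulr_sumr.
(* The rotated sum is [f(z_1 S(z_2)) z_3], which the antipode axiom collapses. *)
suff -> : \sum_(k < \dim {:H}) legl k (P k z) = (f 1 : K) *: z.
  by rewrite !linearZ /= scalerAr.
rewrite /P; under eq_bigr => k _ do rewrite (Sw_push _ _ (lin_legl k)).
rewrite -Sw_sum.
transitivity (Sw (fun p q => Sw (fun q1 q2 => (f (p * S q1) : K) *: q2) q) z).
  apply: eq_Sw => p q; rewrite Sw_legl; last by split; solve_lin.
  by apply: eq_bigr => k _; rewrite (linZ (lin_legl k)).
rewrite -(@SwA _ _ _ (fun p q1 q2 => (f (p * S q1) : K) *: q2)); try by solve_lin.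
rewrite -(@Sw_counitl _ _ _ (fun q => (f 1 : K) *: q)); last by solve_lin.
apply: eq_Sw => y q; rewrite -(@Sw_antipoder _ _ _ (fun z => (f z : K) *: q)) //; solve_lin.
Qed.
End DualIntegral.

(** * The Frobenius structure and its Nakayama automorphism *)

Section Frobenius.
Variables (K : fieldType) (H : hopfAlgType K).
Implicit Types (W X : vectType K) (h g x y : H).
Local Notation S := (@antipode K H).
Variable L : H.
Hypothesis LP : normalized_integral L.

Let hL h : h * L = counit h *: L. Proof. by case: LP. Qed.
Let lS : lin S. Proof. exact: lin_linear. Qed.
Let Lh h : L * h = counit h *: L. Proof. by case: LP. Qed.
Let eL : counit L = 1. Proof. by case: LP. Qed.
Let ll := @lin_lambda K H.

Lemma lin_counit0 : lin (fun x : H => counit x : K^o).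
Proof. exact: (lin_counit (@lin_id _ _)). Qed.

(** The map [x |-> L S^2(x)] has rank one: it is [x |-> counit(x) L]. *)
Lemma lambda_L : lambda L = 1.
Proof.
rewrite /lambda (@eq_ltrace _ _ _ (fun x => (counit x : K) *: L)).
  by rewrite (ltrace_rank1 _ lin_counit0) eL.
by move=> x; rewrite Lh !counit_antipode.
Qed.

(** Since [h L = counit(h) L], the tensor [S(h) L_1 (x) L_2] equals [S(h_1) h_2 L_1 (x) h_3 L_2],
    where [S(h_1) h_2] cancels. *)
Lemma Sw_L_mull W (F : H -> H -> W) h : bil F ->
  Sw (fun a b => F a (h * b)) L = Sw (fun a b => F (S h * a) b) L.
Proof.
move=> [l1 l2]; symmetry.
rewrite -(@Sw_counitr _ _ _ (fun u => Sw (fun a b => F (S u * a) b) L)); last by solve_lin.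
transitivity (Sw (fun u v => Sw (fun v1 v2 => Sw (fun a b => F (S u * v1 * a) (v2 * b)) L) v) h).
  apply: eq_Sw => u v; rewrite -(linZ (@Sw_lin _ _ _ _)) -hL SwM; last by split; solve_lin.
  by apply: eq_Sw => v1 v2; apply: eq_Sw => a b; rewrite mulrA.
rewrite -(@SwA _ _ _ (fun u v1 v2 => Sw (fun a b => F (S u * v1 * a) (v2 * b)) L)); try by solve_lin.
rewrite -(@Sw_counitl _ _ _ (fun v => Sw (fun a b => F a (v * b)) L)); last by solve_lin.
apply: eq_Sw => y v.
rewrite (@Sw_antipodel _ _ _ (fun z => Sw (fun a b => F (z * a) (v * b)) L)); last by solve_lin.
by congr (_ *: _); apply: eq_Sw => a b; rewrite mul1r.
Qed.

Lemma Sw_L_mulr W (F : H -> H -> W) h : bil F ->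
  Sw (fun a b => F (a * h) b) L = Sw (fun a b => F a (b * S h)) L.
Proof.
move=> [l1 l2]; symmetry.
rewrite -(@Sw_counitl _ _ _ (fun v => Sw (fun a b => F a (b * S v)) L)); last by solve_lin.
transitivity (Sw (fun u v => Sw (fun u1 u2 => Sw (fun a b => F (a * u1) (b * (u2 * S v))) L) u) h).
  apply: eq_Sw => u v; rewrite -(linZ (@Sw_lin _ _ _ _)) -Lh SwM; last by split; solve_lin.
  rewrite Sw_exch.
  by apply: eq_Sw => v1 v2; apply: eq_Sw => a b; rewrite mulrA.
rewrite (@SwA _ _ _ (fun u1 u2 v => Sw (fun a b => F (a * u1) (b * (u2 * S v))) L)); try by solve_lin.
rewrite -(@Sw_counitr _ _ _ (fun v => Sw (fun a b => F (a * v) b) L)); last by solve_lin.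
apply: eq_Sw => v y.
rewrite (@Sw_antipoder _ _ _ (fun z => Sw (fun a b => F (a * v) (b * z)) L)); last by solve_lin.
by congr (_ *: _); apply: eq_Sw => a b; rewrite mulr1.
Qed.

(** Moving [h] to the other leg leaves [S(h)] times [lambda(L_2) L_1 = lambda(L) 1 = 1]. Thus the
    legs of [L] serve as dual bases for the form [lambda]. *)
Lemma antipode_lambdaE h : Sw (fun a b => lambda (h * b) *: a) L = S h.
Proof.
rewrite (@Sw_L_mull _ (fun a b => lambda b *: a)); last by split; solve_lin.
rewrite -[RHS]mulr1 -[X in _ * X]scale1r -lambda_L -lambda_left_integral (@Sw_push _ _ _ _ (fun z => S h * z));
  last by solve_lin.
by apply: eq_Sw => a b; rewrite scalerAr.
Qed.

Lemma lambda_antipodeE h : Sw (fun a b => lambda (b * S h) *: a) L = h.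
Proof.
rewrite -(@Sw_L_mulr _ (fun a b => lambda b *: a)); last by split; solve_lin.
rewrite -[RHS]mul1r -[X in X * _]scale1r -lambda_L -lambda_left_integral (@Sw_push _ _ _ _ (fun z => z * h));
  last by solve_lin.
by apply: eq_Sw => a b; rewrite scalerAl.
Qed.

Lemma antipode_inj : injective S.
Proof. by move=> x y e; rewrite -(lambda_antipodeE x) -(lambda_antipodeE y) e. Qed.

Lemma antipode_surj y : exists x, S x = y.
Proof.
pose f := linfun S; have kf : lker f == 0%VS.
  by apply/lker0P => x x'; rewrite !lfunE => /antipode_inj.
by exists ((f^-1)%VF y); have := lker0_lfunVK kf y; rewrite lfunE.
Qed.

Definition rlambda h := lambda (S h).

Lemma lin_rlambda : lin (rlambda : H -> K^o).
Proof. by rewrite /rlambda; solve_lin. Qed.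
Let llr := lin_rlambda.

Lemma rlambda_right_integral h : Sw (fun a b => rlambda a *: b) h = rlambda h *: 1.
Proof.
apply: antipode_inj; rewrite linearZ /= antipode1 -lambda_left_integral Sw_antipode; last by split; solve_lin.
rewrite Sw_push //; apply: eq_Sw => a b; by rewrite linearZ.
Qed.

Lemma rlambda_ltrace h : rlambda h = ltrace (fun x => S (S x) * h).
Proof.
rewrite /rlambda /lambda.
transitivity (ltrace (fun x => S (S x * h))); first by apply: eq_ltrace => x; rewrite antipodeM.
by rewrite (@ltraceC _ _ _ (fun x => S x * h) S); try by solve_lin.
Qed.

Lemma rlambda_L : rlambda L = 1.
Proof.
rewrite rlambda_ltrace (@eq_ltrace _ _ _ (fun x => (counit x : K) *: L)).
  by rewrite (ltrace_rank1 _ lin_counit0) eL.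
by move=> x; rewrite hL !counit_antipode.
Qed.

Lemma rlambda_antipodeE h : Sw (fun a b => rlambda (S h * a) *: b) L = h.
Proof.
rewrite -(@Sw_L_mull _ (fun a b => rlambda a *: b)); last by split; solve_lin.
rewrite -[RHS]mulr1 -[X in _ * X]scale1r -rlambda_L -rlambda_right_integral (@Sw_push _ _ _ _ (fun z => h * z));
  last by solve_lin.
by apply: eq_Sw => a b; rewrite scalerAr.
Qed.

Lemma lambda_ndr h : (forall z, lambda (z * h) = 0) -> h = 0.
Proof.
have [x <-] := antipode_surj h => e; suff -> : x = 0 by rewrite linear0.
rewrite -(lambda_antipodeE x) /Sw /tlift.
by apply: big1 => i _; apply: big1 => j _; rewrite e scale0r scaler0.
Qed.

Lemma rlambda_ndl h : (forall z, rlambda (h * z) = 0) -> h = 0.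
Proof.
have [x <-] := antipode_surj h => e; suff -> : x = 0 by rewrite linear0.
rewrite -(rlambda_antipodeE x) /Sw /tlift.
by apply: big1 => i _; apply: big1 => j _; rewrite e scale0r scaler0.
Qed.

(** Frobenius duality: apply [phi] to the expansion of [y] in [rlambda_antipodeE]. *)
Lemma riesz_rlambda (phi : H -> K^o) y : lin phi ->
  phi y = rlambda (S y * Sw (fun a b => (phi b : K) *: a) L).
Proof.
move=> lp; rewrite -{1}(rlambda_antipodeE y) Sw_push //.
rewrite (@Sw_push _ _ _ K^o (fun z => rlambda (S y * z))); last by solve_lin.
apply: (@eq_Sw _ _ K^o) => a b; rewrite (linZ lp) -scalerAr (linZ llr).
exact: mulrC.
Qed.

Lemma riesz_lambda (phi : H -> K^o) y : lin phi ->
  phi y = lambda (Sw (fun a b => (phi a : K) *: b) L * S y).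
Proof.
move=> lp; rewrite -{1}(lambda_antipodeE y) Sw_push //.
rewrite (@Sw_push _ _ _ K^o (fun z => lambda (z * S y))); last by solve_lin.
apply: (@eq_Sw _ _ K^o) => a b; rewrite (linZ lp) -scalerAl (linZ ll).
exact: mulrC.
Qed.

(** Put [x = S(h)]. As functionals of [y], both sides have the same representing element [S(S(h))]
    in [riesz_rlambda]. *)
Lemma lambda_nakayama x y : lambda (x * y) = lambda (y * S (S x)).
Proof.
have [h <-] := antipode_surj x.
rewrite (@riesz_rlambda (fun y => lambda (S h * y))); last by solve_lin.
rewrite (@riesz_rlambda (fun y => lambda (y * S (S (S h))))); last by solve_lin.
by rewrite antipode_lambdaE lambda_antipodeE.
Qed.

Lemma rlambda_nakayama x y : rlambda (x * y) = rlambda (S (S y) * x).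
Proof. by rewrite /rlambda !antipodeM lambda_nakayama. Qed.

Lemma left_int_unique (mu : H -> K^o) : lin mu ->
  (forall h, Sw (fun a b => (mu b : K) *: a) h = (mu h : K) *: 1) ->
  forall h, mu h = (mu L : K) * lambda h :> K.
Proof.
(* Duality produces [lambda] composed with [S^2]; the same fact for [lambda] itself then removes
   [S^2]. *)
have gen (nu : H -> K^o) : lin nu -> (forall h, Sw (fun a b => (nu b : K) *: a) h = (nu h : K) *: 1) ->
   forall h, nu h = (nu L : K) * lambda (S (S h)) :> K.
  by move=> ln en h; rewrite riesz_rlambda // en -scalerAr mulr1 (linZ llr).
move=> lm em h; rewrite gen // [lambda h](@gen (@lambda K H)) // ?lambda_L ?mul1r //; exact: lambda_left_integral.
Qed.

Lemma right_int_unique (mu : H -> K^o) : lin mu ->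
  (forall h, Sw (fun a b => (mu a : K) *: b) h = (mu h : K) *: 1) ->
  forall h, mu h = (mu L : K) * rlambda h :> K.
Proof. by move=> lm em h; rewrite riesz_lambda // em -scalerAl mul1r (linZ ll). Qed.

(* The distinguished group-like element of [H]. *)
Definition modulus := Sw (fun a b => lambda a *: b) L.
Local Notation g := modulus.

(** For every functional [f], the map [h |-> f(lambda(h_1) h_2)] is again a left integral, so by
    uniqueness it is [lambda] times its value [f(g)] at [L]. *)
Lemma lambda_modulus h : Sw (fun a b => lambda a *: b) h = lambda h *: g.
Proof.
apply: coordP => j; pose f : H -> K^o := coord (vbasis {:H}) j.
have lf : lin f by exact: lin_coord.
rewrite -/(f _) -/(f _) (linZ lf).
pose mu h : K^o := f (Sw (fun a b => lambda a *: b) h).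
have lm : lin mu by rewrite /mu; solve_lin.
rewrite -/(mu h) [X in _ = X]mulrC -[f g]/(mu L) -left_int_unique // => {}h.
transitivity (Sw (fun z q => (f q : K) *: (lambda z *: (1 : H))) h).
  transitivity (Sw (fun x y => Sw (fun p q => (f q : K) *: (lambda p *: x)) y) h).
    apply: eq_Sw => x y; rewrite /mu Sw_push // (@Sw_push _ _ _ _ (fun k : K^o => (k : K) *: x));
  last by solve_lin.
    apply: eq_Sw => p q; rewrite (linZ lf) scalerA; congr (_ *: _); exact: mulrC.
  rewrite -(@SwA _ _ _ (fun x p q => (f q : K) *: (lambda p *: x))); try by solve_lin.
  apply: eq_Sw => z q; by rewrite SwZ lambda_left_integral.
rewrite /mu Sw_push // (@Sw_push _ _ _ _ (fun k : K^o => (k : K) *: (1 : H))); last by solve_lin.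
apply: eq_Sw => z q; rewrite (linZ lf) scalerA; congr (_ *: _); exact: mulrC.
Qed.

(** By [lambda_modulus] used twice, [lambda(L_1) L_2 (x) L_3 = lambda(L_1) g (x) L_2 = g (x) g]. *)
Lemma modulus_grouplike W (F : H -> H -> W) : bil F -> Sw F g = F g g.
Proof.
move=> [l1 l2]; rewrite {1}/modulus (Sw_push _ _ (@Sw_lin _ _ _ F)).
transitivity (Sw (fun a b => Sw (fun b1 b2 => lambda a *: F b1 b2) b) L).
  by apply: eq_Sw => a b; rewrite (linZ (@Sw_lin _ _ _ F)) SwZ.
rewrite -(@SwA _ _ _ (fun a b1 b2 => lambda a *: F b1 b2)); try by solve_lin.
rewrite {2}/modulus (Sw_push _ _ (l2 _)); apply: eq_Sw => y b.
rewrite (linZ (l2 _)) -(linZ (l1 _)) -lambda_modulus (Sw_push _ _ (l1 b)).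
by apply: eq_Sw => a b1; rewrite (linZ (l1 _)).
Qed.

Lemma counit_modulus : counit g = 1.
Proof.
rewrite /modulus (@Sw_push _ _ _ K^o (fun x => counit x)); last exact: lin_counit0.
rewrite -lambda_L -(@Sw_counitr _ _ K^o (@lambda K H) L ll).
by apply: (@eq_Sw _ _ K^o) => a b; rewrite linearZ; exact: mulrC.
Qed.

Lemma modulus_antipoder : g * S g = 1.
Proof.
have := @Sw_antipoder _ H _ idfun g (@lin_id _ _).
by rewrite (@modulus_grouplike _ (fun a b => a * S b)) /= ?counit_modulus ?scale1r //; split; solve_lin.
Qed.

Lemma modulus_antipodel : S g * g = 1.
Proof.
have := @Sw_antipodel _ H _ idfun g (@lin_id _ _).
by rewrite (@modulus_grouplike _ (fun a b => S a * b)) /= ?counit_modulus ?scale1r //; split; solve_lin.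
Qed.

(** The map [h |-> lambda(h g)] is a right integral with value 1 at [L], because [lambda(h_1 g) h_2
    = lambda(h_1 g) h_2 g S(g) = lambda(h g) g S(g)]. *)
Lemma rlambdaE h : rlambda h = lambda (h * g).
Proof.
pose mu h : K^o := lambda (h * g).
have lm : lin mu by rewrite /mu; solve_lin.
rewrite -/(mu h) (@right_int_unique mu) //.
  by rewrite /mu Lh counit_modulus scale1r lambda_L mul1r.
move=> {}h; rewrite /mu.
have -> : lambda (h * g) *: 1 = (lambda (h * g) *: g) * S g by rewrite -scalerAl modulus_antipoder.
rewrite -lambda_modulus SwM; last by split; solve_lin.
rewrite (@Sw_push _ _ _ _ (fun z => z * S g)); last by solve_lin.
apply: eq_Sw => a b; rewrite (@modulus_grouplike _ (fun c d => lambda (a * c) *: (b * d))); last by split; solve_lin.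
by rewrite -scalerAl -mulrA modulus_antipoder mulr1.
Qed.

(** The two Nakayama relations give [lambda(x y g) = rlambda(x y) = rlambda(S^2(y) x) =
    lambda(S^2(y) x g) = lambda(x g S^4(y))], and [lambda] is nondegenerate. *)
Lemma antipode4_modulus y : y * g = g * S (S (S (S y))).
Proof.
apply/eqP; rewrite -subr_eq0; apply/eqP; apply: lambda_ndr => x.
rewrite mulrBr -scaleN1r addrC ll; apply/eqP.
rewrite /GRing.scale /= mulN1r addrC subr_eq0; apply/eqP.
rewrite !mulrA -rlambdaE rlambda_nakayama rlambdaE.
by rewrite -mulrA lambda_nakayama.
Qed.
End Frobenius.

(** * Group-like elements and the order of the antipode *)

Section Grouplike.
Variables (K : fieldType) (H : hopfAlgType K).
Implicit Types (W X : vectType K).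
Local Notation S := (@antipode K H).

(** The condition [Delta(g) = g (x) g], tested on bilinear maps because Sweedler sums are rewritten
    in that form. It admits [g = 0]; nonvanishing enters separately, through a left inverse. *)
Definition grouplike (g : H) := forall W (F : H -> H -> W), bil F -> Sw F g = F g g.

Lemma grouplikeX g n : grouplike g -> grouplike (g ^+ n).
Proof.
move=> gg; elim: n => [|n IHn] W F bF; first by rewrite expr0 Sw1.
have [l1 l2] := bF; rewrite exprS SwM // gg; last by split; solve_lin.
by rewrite IHn //; split; solve_lin.
Qed.

(** If [g] is the sum of the [c_i x_i], then [g (x) g] is the sum of the [c_i x_i (x) x_i]; compare
    the coefficients of [x_k (x) x_l]. *)
Lemma grouplike_coord g n (X : n.-tuple H) (k l : 'I_n) : grouplike g ->
  free X -> g \in <<X>>%VS -> (forall i : 'I_n, grouplike X`_i) ->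
  coord X k g * coord X l g = coord X k g * (k == l)%:R.
Proof.
move=> gg fX gX GX.
have lX i : lin (coord X i : H -> K^o) by exact: lin_coord.
pose F (a b : H) : K^o := coord X k a * coord X l b.
have bF : bil F by rewrite /F; split; solve_lin.
rewrite -[LHS]/(F g g) -gg // {1}(coord_span gX) (lin_sum (@Sw_lin _ _ _ F)).
rewrite (bigD1 k) //= (linZ (@Sw_lin _ _ _ F)) GX // big1 ?addr0 => [|i ik].
  by rewrite /F !coord_free // eqxx mul1r.
rewrite (linZ (@Sw_lin _ _ _ F)) GX // /F coord_free // (negPf ik).
by rewrite mul0r scaler0.
Qed.

(* Distinct powers of [g] are linearly independent, so they cannot all be distinct. *)
Lemma grouplike_order g h : grouplike g -> h * g = 1 -> exists2 N, (0 < N)%N & g ^+ N = 1.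
Proof.
move=> gg hg.
have hgX n : h ^+ n * g ^+ n = 1.
  by elim: n => [|n IHn]; rewrite ?mulr1 // exprSr exprS mulrA -[_ * h * g]mulrA hg mulr1.
have gX0 n : g ^+ n != 0.
  by apply: contraTneq (oner_neq0 H) => e; rewrite -(hgX n) e mulr0 eqxx.
pose X r := mkseq (fun i => g ^+ i) r.
have exr : exists r, ~~ free (X r.+1).
  exists (\dim {:H}); apply/negP => fX.
  have := dimvS (subvf <<X (\dim {:H}).+1>>%VS).
  by rewrite (eqP fX) size_mkseq ltnn.
(* At the least [r] for which [1, ..., g^r] are dependent, [g^r] is a combination of independent
   lower powers. By [grouplike_coord] exactly one coefficient is nonzero, and it is 1. *)
case: (ex_minnP exr) => r nfr minr.
have fX : free (X r).
  case: r nfr minr => [|r] _ minr; first exact: nil_free.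
  by apply/negPn/negP => /minr; rewrite ltnn.
have gX : g ^+ r \in <<in_tuple (X r)>>%VS.
  apply: contraR nfr => ngX; rewrite /X mkseqS (@perm_free _ _ _ (g ^+ r :: X r)) ?perm_rcons //.
  by rewrite free_cons ngX.
have sX : size (X r) = r by rewrite size_mkseq.
have ir (i : 'I_(size (X r))) : (i < r)%N by case: i => i /=; rewrite sX.
have GX (i : 'I_(size (X r))) : grouplike (in_tuple (X r))`_i.
  by rewrite /= nth_mkseq // ?ir //; exact: grouplikeX.
have C (k l : 'I_(size (X r))) := @grouplike_coord _ _ (in_tuple (X r)) k l (grouplikeX r gg) fX gX GX.
have [k ck] : exists k : 'I_(size (X r)), coord (in_tuple (X r)) k (g ^+ r) != 0.
  apply/existsP; apply: contraR (gX0 r) => /existsPn c0.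
  by rewrite (coord_span gX) big1 // => i _; rewrite (eqP (negPn (c0 i))) scale0r.
have grk : g ^+ r = g ^+ k.
  rewrite (coord_span gX) (bigD1 k) //= big1 ?addr0 => [|i ik].
    have := C k k; rewrite eqxx => /(mulfI ck) ->.
    by rewrite scale1r nth_mkseq // ir.
  have := C k i; rewrite eq_sym (negPf ik) => /(mulfI ck) ->.
  by rewrite scale0r.
exists (r - k)%N; first by rewrite subn_gt0 ir.
by rewrite -[LHS]mul1r -(hgX k) -mulrA -exprD subnKC ?grk // ltnW ?ir.
Qed.
End Grouplike.

Section AntipodeOrder.
Variables (K : fieldType) (H : hopfAlgType K) (L : H).
Hypothesis LP : normalized_integral L.
Local Notation S := (@antipode K H).
Local Notation g := (modulus L).

Lemma antipode_iter4 n y : y * g ^+ n = g ^+ n * iter (4 * n) S y.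
Proof.
elim: n y => [|n IHn] y; first by rewrite mulr1 mul1r.
rewrite exprS mulrA antipode4_modulus // -mulrA IHn mulrA mulnS addnC iterD //.
Qed.

Lemma antipode_finite_order : exists2 N, (0 < N)%N & forall y, iter N (fun x => S (S x)) y = y.
Proof.
have [N N0 gN] := grouplike_order (@modulus_grouplike _ _ _ LP) (modulus_antipodel LP).
exists (2 * N)%N => [|y]; first by rewrite muln_gt0.
transitivity (iter (4 * N) S y); last by rewrite -[LHS]mul1r -gN -antipode_iter4 gN mulr1.
rewrite (_ : (4 * N = 2 * (2 * N))%N); last by rewrite mulnA.
elim: (2 * N)%N => // k IHk.
by rewrite mulnS iterS iterD IHk.
Qed.
End AntipodeOrder.

(** * Traces and roots of unity *)

Section MatrixTrace.
Variable K : fieldType.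

(** In a full-rank factorization [A = C R], idempotence forces [R C = 1], a matrix of size
    [\rank A]. *)
Lemma mxtrace_idempotent n (A : 'M[K]_n) : A *m A = A -> \tr A = (\rank A)%:R.
Proof.
move=> AA; rewrite -{1}(mulmx_base A) mxtrace_mulC.
suff -> : row_base A *m col_base A = 1%:M by rewrite mxtrace1.
apply: (row_free_inj (row_base_free A)); apply: (@row_full_inj _ _ _ _ (col_base A)).
  exact: col_base_full.
rewrite mul1mx; move: (col_base A) (row_base A) (mulmx_base A) => C R CR.
by rewrite !mulmxA CR -mulmxA CR AA.
Qed.

(** [A] is annihilated by [X (X^M - 1)], which has distinct roots here, so it is diagonalizable with
    eigenvalues 0 and [M]-th roots of unity. The list [s] omits the eigenvalue 0, hence the
    condition [0 < k]. *)
Lemma mxtrace_exp_roots n (A : 'M[K]_n) M (z : K) :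
  M.-primitive_root z -> A ^+ M.+1 = A ->
  exists s : seq nat, forall k, (0 < k)%N -> \tr (A ^+ k) = \sum_(a <- s) z ^+ (a * k).
Proof.
case: n A => [|n] A pz AM.
  by exists [::] => k _; rewrite big_nil /mxtrace big_ord0.
have M0 := prim_order_gt0 pz.
have : diagonalizable A.
  apply/diagonalizableP; exists (0 :: [seq z ^+ i | i <- iota 0 M]).
    rewrite /= map_inj_in_uniq ?iota_uniq ?andbT.
      apply/negP=> /mapP[i _ /esym/eqP]; rewrite expf_eq0 => /andP[_ /eqP z0].
      by have := prim_expr_order pz; rewrite z0 expr0n -[M]prednK // => /eqP; rewrite eq_sym oner_eq0.
    move=> i j; rewrite !mem_iota !add0n /= => iM jM /eqP.
    by rewrite (eq_prim_root_expr pz) !modn_small // => /eqP.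
  rewrite big_cons big_map.
  have -> : \prod_(j <- iota 0 M) ('X - (z ^+ j)%:P) = 'X^M - 1.
    by rewrite -(factor_Xn_sub_1 pz) /index_iota subn0.
  apply: mxminpoly_min; rewrite subr0 rmorphM rmorphB /= horner_mx_X rmorphXn /= horner_mx_X rmorph1.
  by rewrite mulrBr mulr1 -[A * _]/(A * A ^+ M) -exprS AM subrr.
case=> P Pu /(diagonalizable_forLR Pu)[D AD].
have AE k : A ^+ k = invmx P *m diag_mx (\row_i (D 0 i ^+ k)) *m P.
  rewrite mxpoly.conjVmx // in AD; rewrite AD; elim: k => [|k IHk].
    rewrite expr0 (_ : diag_mx _ = 1%:M) ?mulmx1 ?mulVmx //.
    by apply/matrixP=> i j; rewrite !mxE.
  rewrite exprS IHk -[_ * _]/(_ *m _) !mulmxA mulmxK // -!mulmxA; congr (_ *m _).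
  rewrite !mulmxA; congr (_ *m _).
  by rewrite mulmx_diag; congr diag_mx; apply/rowP => i; rewrite !mxE exprS.
have DM i : D 0 i ^+ M.+1 = D 0 i.
  have := AE M.+1; rewrite AM -[in X in X = _](expr1 A) AE => /(congr1 (fun B => P *m B *m invmx P)).
  rewrite !mulmxA !mulmxV // !mul1mx -!mulmxA mulmxV // !mulmx1 => /matrixP/(_ i i).
  by rewrite !mxE eqxx /= expr1.
have /fin_all_exists[a aP] (i : 'I_n.+1) : exists a : nat, D 0 i != 0 -> D 0 i = z ^+ a.
  have [->|Di0] := eqVneq (D 0 i) 0; first by exists 0%N.
  have /(prim_rootP pz)[a ->] : D 0 i ^+ M = 1.
    by apply: (mulfI Di0); rewrite -exprS DM mulr1.
  by exists a.
exists [seq a i | i <- enum 'I_n.+1 & D 0 i != 0] => k k0.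
rewrite AE mxtrace_mulC mulmxA mulmxV // mul1mx big_map big_filter big_enum_cond /=.
rewrite mxtrace_diag (bigID (fun i => D 0 i != 0)) /= [X in _ + X]big1 ?addr0.
  by apply: eq_big => i //= Di; rewrite mxE {1}aP // exprM.
by move=> i /negPn/eqP Di; rewrite mxE Di expr0n -[k]prednK.
Qed.
End MatrixTrace.

(** * Integral relations between roots of unity *)

Section Cyclotomic.
Import Num.Theory.
Variable K : fieldType.
Hypothesis charK0 : [pchar K] =i pred0.

Local Notation pK := (map_poly (intr : int -> K)).
Local Notation pC := (map_poly (intr : int -> algC)).
Local Notation pQtoC := (map_poly (ratr : rat -> algC)).

Lemma natr_eq0_char0 k : (k%:R == 0 :> K) = (k == 0%N).
Proof. by rewrite (pcharf0P K).1. Qed.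

Lemma intr_eq0_char0 (a : int) : (a%:~R == 0 :> K) = (a == 0).
Proof. by case: a => n; rewrite ?NegzE ?mulrNz ?oppr_eq0 ?pmulrn natr_eq0_char0. Qed.

(** As a root of [X^n - 1], [z] is a root of some ['Phi_d] with [d] dividing [n]; then [z^d = 1]
    forces [d = n]. *)
Lemma root_Cyclotomic n (z : K) : n.-primitive_root z -> (pK 'Phi_n).[z] = 0.
Proof.
move=> pz; have n0 := prim_order_gt0 pz.
have := prod_Cyclotomic n0 => /(congr1 (fun p => (pK p).[z])).
rewrite rmorph_prod rmorphB rmorphXn /= map_polyX rmorph1 hornerD hornerN hornerXn hornerC.
rewrite (prim_expr_order pz) subrr horner_prod => /eqP; rewrite prodf_seq_eq0 => /hasP[d].
rewrite -dvdn_divisors // => dn /= /eqP Pd0.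
have d0 : (0 < d)%N by apply: dvdn_gt0 dn.
have : z ^+ d = 1.
  have := prod_Cyclotomic d0 => /(congr1 (fun p => (pK p).[z])).
  rewrite rmorph_prod rmorphB rmorphXn /= map_polyX rmorph1 hornerD hornerN hornerXn hornerC.
  rewrite horner_prod (big_rem d) /=; last by rewrite -dvdn_divisors.
  by rewrite Pd0 mul0r => /esym/eqP; rewrite subr_eq0 => /eqP.
move/eqP; rewrite -(prim_order_dvd pz) => nd.
by have /eqP <- : d == n by rewrite eqn_dvd dn nd.
Qed.

(** Division by the monic ['Phi_n] stays over the integers, and the remainder vanishes at [z] while
    its degree is below that of the minimal polynomial. *)
Lemma Cyclotomic_dvd n (z : algC) p : n.-primitive_root z -> (pC p).[z] = 0 ->
  exists q, p = q * 'Phi_n.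
Proof.
move=> pz p0; have mP := Cyclotomic_monic n.
exists (Pdiv.Ring.rdivp p 'Phi_n); rewrite {1}(Pdiv.RingMonic.rdivp_eq mP p).
suff -> : Pdiv.Ring.rmodp p 'Phi_n = 0 by rewrite addr0.
set r := Pdiv.Ring.rmodp p 'Phi_n.
have r0 : (pC r).[z] = 0.
  have := p0; rewrite (Pdiv.RingMonic.rdivp_eq mP p) rmorphD rmorphM /= hornerD hornerM.
  rewrite (Cintr_Cyclotomic pz) (_ : (cyclotomic z n).[z] = 0) ?mulr0 ?add0r //.
  by apply/eqP; rewrite -/(root _ z) (root_cyclotomic pz).
have [q [Dq _] root_q] := minCpolyP z.
have sq : size q = (totient n).+1.
  by rewrite -(size_cyclotomic z n) -(minCpoly_cyclotomic pz) Dq size_map_poly.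
have : root (pQtoC (map_poly intr r)) z.
  by rewrite -map_poly_comp (eq_map_poly (ratr_int _)) /root r0.
rewrite root_q => qr; apply/eqP/negPn/negP => rn0.
have szr : size (map_poly (intr : int -> rat) r) = size r.
  by rewrite size_map_poly_id0 // intr_eq0 lead_coef_eq0.
have := dvdp_leq _ qr; rewrite -size_poly_gt0 szr size_poly_gt0 rn0 => /(_ isT).
rewrite sq -(size_Cyclotomic n) leqNgt.
by rewrite (Pdiv.Ring.ltn_rmodpN0 p (monic_neq0 mP)).
Qed.

(** This allows positivity and Galois arguments to be made in [algC]. If [p] does not vanish at [z],
    it is coprime to ['Phi_n] over the rationals; a Bezout identity with denominators cleared,
    evaluated at [zK], would make a nonzero integer vanish in [K]. *)
Lemma root_transfer n (zK : K) (z : algC) p : n.-primitive_root zK -> n.-primitive_root z ->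
  (pK p).[zK] = 0 <-> (pC p).[z] = 0.
Proof.
move=> pzK pz; split=> [pK0|/(Cyclotomic_dvd pz)[q ->]]; last first.
  by rewrite rmorphM hornerM root_Cyclotomic ?mulr0.
apply/eqP; apply: contraT => pn0.
have [q [Dq _] root_q] := minCpolyP z.
have DqZ : q = map_poly intr 'Phi_n.
  apply: (map_poly_inj (@ratr algC)); rewrite -Dq (minCpoly_cyclotomic pz) -(Cintr_Cyclotomic pz).
  by rewrite -map_poly_comp (eq_map_poly (ratr_int _)).
pose pQ : {poly rat} := map_poly intr p.
have npQ : ~~ (q %| pQ).
  by rewrite -root_q -map_poly_comp (eq_map_poly (ratr_int _)).
(* Irreducibility of [q]: [z] is a root of the gcd or of its cofactor. The gcd is excluded since [q]
   does not divide [pQ], and the cofactor then has the degree of [q]. *)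
have cop : coprimep pQ q.
  have gq : gcdp pQ q %| q by exact: dvdp_gcdr.
  have qn0 : q != 0 by apply: contraNneq npQ => q0; move: Dq; rewrite q0 rmorph0 => /eqP; rewrite minCpoly_eq0.
  have qE := divpK gq; have : root (pQtoC q) z by rewrite -Dq root_minCpoly.
  rewrite -{1}qE rmorphM rootM !root_q => /orP[qd|]; last first.
    by move=> /dvdp_trans/(_ (dvdp_gcdl _ _)); rewrite (negPf npQ).
  have dn0 : q %/ gcdp pQ q != 0 by apply: contraNneq qn0 => d0; rewrite -qE d0 mul0r.
  have gn0 : gcdp pQ q != 0 by apply: contraNneq qn0 => d0; rewrite -qE d0 mulr0.
  have := dvdp_leq dn0 qd; have := size_mul dn0 gn0; rewrite qE => ->.
  rewrite -size_poly_gt0 in dn0; rewrite -size_poly_gt0 in gn0.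
  rewrite /coprimep; move: dn0 gn0; set a := size _; set b := size _.
  case: a b => // a [|[|b]] // _ _.
  by rewrite addSn !addnS /= ltnS ltnNge leq_addr.
have [[u v] /= uv1] := Bezout_eq1_coprimepP _ _ cop.
have [u' [a an0 Du]] := rat_poly_scale u; have [v' [b bn0 Dv]] := rat_poly_scale v.
have E : b *: (u' * p) + a *: (v' * 'Phi_n) = (a * b)%:P.
  apply: (@map_inj_poly _ _ (intr : int -> rat) (@intr_inj _) (mulr0z _)).
  have := congr1 (fun w => (a * b)%:~R *: w) uv1; rewrite Du Dv DqZ.
  rewrite alg_polyC map_polyC /= => <-.
  rewrite rmorphD /= !map_polyZ !rmorphM /= scalerDr -!scalerAl !scalerA.
  congr (_ *: _ + _ *: _); last by rewrite mulfK ?intr_eq0.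
  by rewrite mulrAC mulfV ?intr_eq0 // mul1r.
have := congr1 (fun p => (pK p).[zK]) E.
rewrite /= rmorphD /= !map_polyZ !rmorphM /= !map_polyC /= hornerD !hornerZ !hornerM !hornerC.
rewrite root_Cyclotomic // pK0 !mulr0 addr0 => /esym/eqP.
by rewrite mulf_eq0 !intr_eq0_char0 => /orP[/idPn|/idPn].
Qed.

(* The summands are [|s_i|^2 / d_i], because [z^(n-1)] is the conjugate of [z]. *)
Lemma sum_norm_neq0 n (z : K) (I : finType) (i0 : I) (d : I -> nat) (s : I -> seq nat) :
  n.-primitive_root z -> (forall i, (0 < d i)%N) ->
  \sum_(a <- s i0) z ^+ a != 0 ->
  \sum_i (\sum_(a <- s i) z ^+ a) * (\sum_(a <- s i) z ^+ (a * n.-1)) / (d i)%:R != 0.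
Proof.
move=> pz d0 s0; have n0 := prim_order_gt0 pz; have [zC pzC] := C_prim_root_exists n0.
pose f (i : I) : {poly int} := \sum_(a <- s i) 'X^a.
pose f' (i : I) : {poly int} := \sum_(a <- s i) 'X^(a * n.-1).
(* A common denominator, which turns the sum into the value of an integer polynomial. *)
pose D := (\prod_i d i)%N.
have dD i : (d i %| D)%N by rewrite /D (bigD1 i) //= dvdn_mulr.
have D0 : (0 < D)%N by rewrite prodn_gt0.
pose P := \sum_i (D %/ d i)%:Z *: (f i * f' i).
have fE (R : nzRingType) (x : R) i : (map_poly intr (f i)).[x] = \sum_(a <- s i) x ^+ a.
  by rewrite /f rmorph_sum horner_sum; apply: eq_bigr => a _; rewrite /= map_polyXn hornerXn.
have fE' (R : nzRingType) (x : R) i : (map_poly intr (f' i)).[x] = \sum_(a <- s i) x ^+ (a * n.-1).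
  by rewrite /f' rmorph_sum horner_sum; apply: eq_bigr => a _; rewrite /= map_polyXn hornerXn.
apply/eqP => sum0; move/eqP: s0; apply.
rewrite -fE; apply/(root_transfer _ pz pzC); rewrite fE.
have /(root_transfer _ pz pzC) : (pK P).[z] = 0.
  rewrite -(mulr0 D%:R) -sum0 mulr_sumr /P rmorph_sum horner_sum; apply: eq_bigr => i _ /=.
  rewrite map_polyZ rmorphM /= hornerZ hornerM fE fE'.
  have di : (d i)%:R != 0 :> K by rewrite natr_eq0_char0 -lt0n.
  rewrite -[in RHS](divnK (dD i)) natrM -mulrA; congr (_ * _).
  by rewrite [RHS]mulrC divfK.
rewrite /P rmorph_sum horner_sum => /= PC.
have conjz a : zC ^+ (a * n.-1) = (zC ^+ a)^*.
  rewrite rmorphXn mulnC exprM; congr (_ ^+ _).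
  have nz : `|zC| = 1.
    by apply/eqP; rewrite -(pexpr_eq1 n0) // -normrX (prim_expr_order pzC) normr1.
  have z0 : zC != 0 by rewrite -normr_eq0 nz oner_eq0.
  apply: (mulfI z0); rewrite -normCK nz expr1n -exprS prednK //.
  exact: prim_expr_order.
have termE i : (pC ((D %/ d i)%:Z *: (f i * f' i))).[zC] =
    (D %/ d i)%:R * `|\sum_(a <- s i) zC ^+ a| ^+ 2.
  rewrite map_polyZ rmorphM /= hornerZ hornerM fE fE' normCK; congr (_ * (_ * _)).
  by rewrite rmorph_sum; apply: eq_bigr => a _; rewrite conjz.
have /psumr_eq0P : forall i : I, true -> 0 <= (pC ((D %/ d i)%:Z *: (f i * f' i))).[zC].
  by move=> i _; rewrite termE mulr_ge0 ?ler0n // exprn_ge0.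
move=> /(_ PC i0 isT); rewrite termE => /eqP; rewrite mulf_eq0 pnatr_eq0 expf_eq0 normr_eq0 /=.
by rewrite -leqn0 leqNgt divn_gt0 // dvdn_leq //= => /eqP.
Qed.

(* [n p(z^e) = q(z^m)] lies in the intersection of the [m]-th and the [e]-th
   cyclotomic fields, which is the field of rationals. *)
Lemma cyclotomic_intersection m e n (z : K) (s t : seq nat) :
  (m * e).-primitive_root z -> coprime m e -> (0 < n)%N ->
  n%:R * \sum_(a <- s) z ^+ (e * a) = \sum_(a <- t) z ^+ (m * a) ->
  exists c : int, \sum_(a <- s) z ^+ (e * a) = c%:~R.
Proof.
move=> pz cop n0 eqK; have me0 := prim_order_gt0 pz; have [zC pzC] := C_prim_root_exists me0.
pose p : {poly int} := \sum_(a <- s) 'X^(e * a).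
pose q : {poly int} := \sum_(a <- t) 'X^(m * a).
have pE (R : nzRingType) (x : R) : (map_poly intr p).[x] = \sum_(a <- s) x ^+ (e * a).
  by rewrite /p rmorph_sum horner_sum; apply: eq_bigr => a _; rewrite /= map_polyXn hornerXn.
have qE (R : nzRingType) (x : R) : (map_poly intr q).[x] = \sum_(a <- t) x ^+ (m * a).
  by rewrite /q rmorph_sum horner_sum; apply: eq_bigr => a _; rewrite /= map_polyXn hornerXn.
pose y := (pC p).[zC].
have eqC : n%:R * y = (pC q).[zC].
  apply/eqP; rewrite -subr_eq0 /y; apply/eqP.
  have := (root_transfer (n%:Z *: p - q) pz pzC).1.
  rewrite !rmorphB /= !map_polyZ !hornerD !hornerN !hornerZ => -> //=.
  by rewrite pE qE eqK subrr.
have conj k : coprime k (m * e) -> (pC p).[zC ^+ k] = y.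
  rewrite coprimeMr => /andP[km ke].
  (* The automorphism [z |-> z^k'] fixes [z^m] and raises [z^e] to the power [k]. The right-hand
     side is therefore fixed, and so is the left-hand side. *)
  pose k' := chinese m e k 1.
  have k'm : k' = k %[mod m] by rewrite chinese_modl.
  have k'e : k' = 1 %[mod e] by rewrite chinese_modr.
  have cop' : coprime k' (m * e).
    by rewrite coprimeMr -[coprime k' m]coprime_modl k'm coprime_modl km -coprime_modl k'e coprime_modl coprime1n.
  have [u uP] := Qn_aut_exists cop'.
  have uz : u zC = zC ^+ k' by rewrite uP // (prim_expr_order pzC).
  have upol (r : {poly int}) : u (pC r).[zC] = (pC r).[zC ^+ k'].
    by rewrite -uz -horner_map -map_poly_comp (eq_map_poly (fun a => rmorph_int u a)).
  transitivity (pC p).[zC ^+ k'].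
    rewrite !pE; apply: eq_bigr => a _; rewrite -!exprM; apply/eqP.
    rewrite (eq_prim_root_expr pzC) !(mulnC _ (e * a)%N) -!mulnA (mulnC m) -!muln_modr.
    by rewrite -(modnMmr _ k) -k'm modnMmr.
  have n0C : n%:R != 0 :> algC by rewrite pnatr_eq0 -lt0n.
  apply: (mulfI n0C); rewrite -upol -/y -{1}(rmorph_nat u n) -rmorphM eqC upol !qE.
  apply: eq_bigr => a _; rewrite -!exprM; apply/eqP.
  rewrite (eq_prim_root_expr pzC) (mulnC k') -mulnA -!muln_modr.
  by rewrite -(modnMmr a k') k'e modnMmr muln1.
have mP := Cyclotomic_monic (m * e); set Phi := 'Phi_(m * e) in mP.
pose r := Pdiv.Ring.rmodp p Phi.
have pE' : p = Pdiv.Ring.rdivp p Phi * Phi + r by exact: Pdiv.RingMonic.rdivp_eq.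
have rk k : coprime k (m * e) -> (pC r).[zC ^+ k] = y.
  move=> ck; rewrite -(conj k ck) {1}pE' rmorphD rmorphM /= hornerD hornerM.
  rewrite (Cintr_Cyclotomic pzC) (_ : (cyclotomic zC (m * e)).[_] = 0) ?mulr0 ?add0r //.
  by apply/eqP; rewrite -/(root _ _) (root_cyclotomic pzC) prim_root_exp_coprime.
(* All primitive roots of order [m e] are roots of [r - y], whose degree is less than their number.
   So [r] is constant, and its integer coefficient is also the value in [K]. *)
have rC : pC r = y%:P.
  apply/eqP; rewrite -subr_eq0; apply: contraTT (Pdiv.Ring.ltn_rmodpN0 p (monic_neq0 mP)).
  move=> nz; rewrite -/r -leqNgt.
  pose rs := [seq zC ^+ k | k <- index_iota 0 (m * e) & coprime k (m * e)].
  have srs : size rs = totient (m * e).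
    rewrite size_map size_filter -sum1_count totient_count_coprime big_mkcond.
    by apply: eq_bigr => k _; rewrite coprime_sym; case: coprime.
  have : all (root (pC r - y%:P)) rs.
    apply/allP => x /mapP[k]; rewrite mem_filter => /andP[ck _] ->.
    by rewrite /root !hornerE rk // subrr.
  have : uniq rs.
    rewrite map_inj_in_uniq ?filter_uniq ?iota_uniq // => i j.
    rewrite !mem_filter !mem_index_iota => /and3P[_ _ im] /and3P[_ _ jm] /eqP.
    by rewrite (eq_prim_root_expr pzC) !modn_small // => /eqP.
  move=> urs ars; have := max_poly_roots nz ars urs; rewrite srs => lt1.
  rewrite /Phi size_Cyclotomic.
  have := leq_trans lt1 (size_polyD _ _); rewrite size_polyN leq_max.
  rewrite size_map_inj_poly ?mulr0z //; last exact: intr_inj.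
  case/orP => // /leq_trans/(_ (size_polyC_leq1 _)).
  by rewrite ltnS leqNgt totient_gt0 me0.
have rc : r = (r`_0)%:P.
  apply: (@map_inj_poly _ _ (intr : int -> algC) (@intr_inj _) (mulr0z _)).
  rewrite map_polyC /= rC; congr _%:P.
  by have := congr1 (fun w : {poly _} => w`_0) rC; rewrite coef_map coefC /= => ->.
exists r`_0; rewrite -pE pE' rmorphD rmorphM /= hornerD hornerM.
by rewrite root_Cyclotomic // mulr0 add0r {1}rc map_polyC hornerC.
Qed.
End Cyclotomic.

Section MatrixOf.
Variables (K : fieldType) (V : vectType K).

Definition mxl (f : V -> V) : 'M[K]_(\dim {:V}) :=
  \matrix_(i, j) coord (vbasis {:V}) i (f (vbasis {:V})`_j).

Lemma mxtrace_mxl f : \tr (mxl f) = ltrace f.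
Proof. by apply: eq_bigr => i _; rewrite mxE. Qed.

Lemma eq_mxl f g : (forall x, f x = g x) -> mxl f = mxl g.
Proof. by move=> e; apply/matrixP => i j; rewrite !mxE e. Qed.

Lemma mxl_comp f g : lin f -> mxl (fun x => f (g x)) = mxl f *m mxl g.
Proof.
move=> lf; apply/matrixP => i j; rewrite !mxE [in LHS](basisE (g _)) (lin_sum lf) linear_sum.
by apply: eq_bigr => k _; rewrite (linZ lf) linearZ /= mulrC !mxE.
Qed.

Lemma mxl_id : mxl id = 1%:M.
Proof.
apply/matrixP => i j; rewrite !mxE coord_free 1?eq_sym //.
exact: (basis_free (vbasisP _)).
Qed.

Lemma mxl_eq0 f : lin f -> mxl f = 0 -> forall x, f x = 0.
Proof.
move=> lf /matrixP f0 x; rewrite (basisE x) (lin_sum lf) big1 // => j _; rewrite (linZ lf).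
rewrite [f _]basisE big1 ?scaler0 // => i _.
by have := f0 i j; rewrite !mxE => ->; rewrite scale0r.
Qed.

Lemma ltrace_idempotent f : lin f -> (forall x, f (f x) = f x) -> ltrace f = (\rank (mxl f))%:R.
Proof.
by move=> lf ff; rewrite -mxtrace_mxl mxtrace_idempotent // -mxl_comp //; exact: eq_mxl.
Qed.

Lemma ltrace_id : ltrace (@id V) = (\dim {:V})%:R.
Proof. by rewrite -mxtrace_mxl mxl_id mxtrace1. Qed.

Lemma lin_inj_surj (f : V -> V) : lin f -> (forall x, f x = 0 -> x = 0) -> forall y, exists x, f x = y.
Proof.
move=> lf f0 y; pose g := linfun (pack_lin lf).
have gE x : g x = f x by rewrite lfunE.
have kg : lker g == 0%VS.
  by rewrite -subv0; apply/subvP => x; rewrite memv_ker memv0 gE => /eqP/f0 ->.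
by exists (g^-1%VF y); rewrite -gE lker0_lfunVK.
Qed.
End MatrixOf.

Lemma prim_root_exists (K : closedFieldType) n :
  [pchar K] =i pred0 -> (0 < n)%N -> exists z : K, n.-primitive_root z.
Proof.
move=> charK0 n0; pose p : {poly K} := 'X^n - 1.
have [r Dp] := closed_field_poly_normal p.
rewrite (monicP _) ?monicXnsubC // scale1r in Dp.
have sr : (n <= size r)%N.
  by rewrite -ltnS -(size_prod_XsubC r id) -Dp size_XnsubC.
have ur : uniq r.
  by rewrite -separable_prod_XsubC -Dp separable_Xn_sub_1 // natr_eq0_char0 // -lt0n.
have ar : all n.-unity_root r by apply/allP => z; rewrite -root_prod_XsubC -Dp.
by case/hasP: (has_prim_root n0 ar ur sr) => z _; exists z.
Qed.

(** * The Larson-Radford theorem *)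

Section Semisimple.
Variables (K : fieldType) (H : hopfAlgType K).
Hypothesis charK0 : [pchar K] =i pred0.
Hypothesis ssH : semisimple H.

(** Take for [e] the component of 1 in [I] along a complement [J]: [x - x e] lies in both. *)
Lemma left_ideal_idempotent (I : {vspace H}) : left_ideal I ->
  exists2 e, e \in I & forall x, x \in I -> x * e = x.
Proof.
move=> lI; have [J [lJ IJ IJ0]] := ssH lI.
have /memv_addP[e eI [f fJ e1]] : 1 \in (I + J)%VS by rewrite IJ memvf.
exists e => // x xI; apply/eqP; rewrite eq_sym -subr_eq0 -memv0 -IJ0 memv_cap.
rewrite rpredB ?lI //=.
suff -> : x - x * e = x * f by exact: lJ.
by rewrite -{1}[x]mulr1 e1 mulrDr addrAC subrr add0r.
Qed.

Definition regchar (h : H) : K := ltrace (fun x => h * x).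

Lemma lin_regchar : lin (regchar : H -> K^o).
Proof. by apply: lin_ltrace => x; solve_lin. Qed.

Lemma regcharC x y : regchar (x * y) = regchar (y * x).
Proof.
rewrite /regchar; transitivity (ltrace (fun z => x * (y * z))); first by apply: eq_ltrace => z; rewrite mulrA.
rewrite (@ltraceC _ _ _ (fun z => y * z) (fun z => x * z)); [|solve_lin|solve_lin].
by apply: eq_ltrace => z; rewrite mulrA.
Qed.

(** The radical of the trace form is a left ideal, hence has an idempotent [e] as right unit. The
    rank of [e] is its trace, which is 0, so [e = 0] in characteristic zero. *)
Lemma regchar_nd h : (forall x, regchar (h * x) = 0) -> h = 0.
Proof.
have lr := lin_regchar.
pose T i : 'Hom(H, K^o) := linfun (pack_lin (lin_comp lr (@lin_mull _ _ _ idfun (vbasis {:H})`_i (@lin_id _ _)))).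
pose I := (\bigcap_(i < \dim {:H}) lker (T i))%VS.
have IP x : x \in I <-> forall y, regchar (x * y) = 0.
  split=> [/subv_bigcapP xI y|x0].
    rewrite (basisE y) mulr_sumr (lin_sum lr) big1 // => i _.
    rewrite -scalerAr (linZ lr).
    by have := xI i isT; rewrite -memvE memv_ker lfunE /= => /eqP ->; rewrite scaler0.
  by apply/subv_bigcapP => i _; rewrite -memvE memv_ker lfunE /= x0.
have lI : left_ideal I.
  by move=> y x /IP xI; apply/IP => u; rewrite -mulrA regcharC -mulrA xI.
have [e /IP eI eP] := left_ideal_idempotent lI.
have ee : e * e = e by apply/eP/IP.
have e0 : e = 0.
  have := eI 1; rewrite mulr1 /regchar ltrace_idempotent; last 2 first.
  - by solve_lin.
  - by move=> x; rewrite mulrA ee.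
  move/eqP; rewrite natr_eq0_char0 // mxrank_eq0 => /eqP /mxl_eq0 r0.
  by rewrite -[e]mulr1; apply: (r0 _ 1); solve_lin.
by move/IP/eP => <-; rewrite e0 mulr0.
Qed.

Lemma riesz_regchar (phi : H -> K^o) : lin phi -> exists w, forall h, phi h = regchar (w * h).
Proof.
have lr := lin_regchar; move=> lp; pose e_ := vbasis {:H}.
pose f h := \sum_(i < \dim {:H}) regchar (h * e_`_i) *: e_`_i.
have lf : lin f by apply: lin_bigsum => i; solve_lin.
have fe : free e_ by exact: (basis_free (vbasisP _)).
have cf h i : coord e_ i (f h) = regchar (h * e_`_i) by rewrite coord_sum_free.
have [|w fw] := lin_inj_surj lf _ (\sum_(i < \dim {:H}) (phi e_`_i : K) *: e_`_i).
  move=> x fx; apply: regchar_nd => y; rewrite (basisE y) mulr_sumr (lin_sum lr) big1 // => i _.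
  by rewrite -scalerAr (linZ lr) -cf fx linear0 scaler0.
exists w => h; rewrite (basisE h) mulr_sumr (lin_sum lr) (lin_sum lp); apply: eq_bigr => i _.
rewrite -scalerAr (linZ lr) (linZ lp) -cf fw; congr (_ *: _).
by rewrite (@coord_sum_free _ _ _ _ (fun i => (phi e_`_i : K))).
Qed.

(** The left ideal [H z] has an idempotent right unit [e = h z], and
    [e = e^(m+1) = h^(m+1) z^(m+1) = 0]. *)
Lemma central_nilpotent_eq0 (z : H) m : (forall x, z * x = x * z) -> z ^+ m = 0 -> z = 0.
Proof.
move=> cz zm; pose I := limg (amulr z).
have IP x : x \in I <-> exists h, x = h * z.
  split=> [/memv_imgP[h _ ->]|[h ->]]; first by exists h; rewrite lfunE.
  by rewrite (_ : h * z = amulr z h) ?memv_img ?memvf // lfunE.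
have lI : left_ideal I by move=> y x /IP[h ->]; apply/IP; exists (y * h); rewrite mulrA.
have [e /IP[h eh] eP] := left_ideal_idempotent lI.
have ee : e * e = e by apply/eP/IP; exists h.
have eX k : e ^+ k.+1 = e by elim: k => [|k IHk]; rewrite ?expr1 // exprS IHk.
have e0 : e = 0.
  rewrite -(eX m) eh exprMn_comm; last exact/esym/cz.
  by rewrite [z ^+ _]exprSr zm mul0r mulr0.
rewrite -[z](eP) ?e0 ?mulr0 //.
by apply/IP; exists 1; rewrite mul1r.
Qed.

Lemma algebraic_element (q : H) : exists2 p : {poly K}, p != 0 & horner_alg q p = 0.
Proof.
pose n := \dim {:H}.
pose M : 'M[K]_(n.+1, n) := \matrix_(i, j) coord (vbasis {:H}) j (q ^+ i).
have kM : kermx M != 0.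
  by rewrite -mxrank_eq0 mxrank_ker subn_eq0 -ltnNge ltnS rank_leq_col.
pose u := nz_row (kermx M).
have u0 : u != 0 by rewrite nz_row_eq0.
have uM : u *m M = 0 by apply/sub_kermxP/nz_row_sub.
pose p : {poly K} := \sum_(i < n.+1) u 0 i *: 'X^i.
have pi (i : 'I_n.+1) : p`_i = u 0 i.
  rewrite coef_sum (bigD1 i) //= coefZ coefXn eqxx mulr1 big1 ?addr0 // => j ji.
  by rewrite coefZ coefXn eq_sym (inj_eq val_inj) (negPf ji) mulr0.
exists p.
  by apply: contraNneq u0 => p0; apply/eqP/rowP => i; rewrite -pi p0 coef0 mxE.
rewrite linear_sum; apply: coordP => j; rewrite linear_sum linear0 /=.
transitivity ((u *m M) 0 j); last by rewrite uM mxE.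
rewrite mxE; apply: eq_bigr => i _.
by rewrite linearZ /= mulr_algl rmorphXn /= horner_algX linearZ mxE.
Qed.
End Semisimple.

Section Spectrum.
Variables (K : closedFieldType) (H : hopfAlgType K).
Hypothesis charK0 : [pchar K] =i pred0.
Hypothesis ssH : semisimple H.

(* A central element of a semisimple algebra is diagonalizable; the Lagrange
   polynomials at its eigenvalues give the spectral idempotents. *)
Lemma central_spectrum (q : H) : (forall x, q * x = x * q) ->
  exists n (a : 'I_n -> K) (e : 'I_n -> H),
  [/\ \sum_i e i = 1, forall i, e i * e i = e i, forall i, q * e i = a i *: e i
    & forall i x, e i * x = x * e i].
Proof.
move=> cq; pose ev := horner_alg q.
have cev p x : ev p * x = x * ev p.
  rewrite /ev; elim/poly_ind: p => [|p c IHp]; first by rewrite rmorph0 mul0r mulr0.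
  rewrite rmorphD rmorphM /= horner_algX horner_algC mulrDl mulrDr -mulrA cq !mulrA IHp.
  by rewrite -mulrA -cq !mulrA -scalerAl -scalerAr mul1r mulr1.
have [p p0 evp] := algebraic_element q.
have [r Dp] := closed_field_poly_normal p.
pose ks := undup r; pose s := \prod_(k <- ks) ('X - k%:P).
have dvs t : {subset t <= ks} -> \prod_(k <- t) ('X - k%:P) %| s ^+ size t.
  elim: t => [|k t IHt] tk; first by rewrite big_nil expr0 dvdpp.
  rewrite big_cons exprS dvdp_mul //; last by apply: IHt => x xt; rewrite tk ?inE ?xt ?orbT.
  by rewrite dvdp_XsubCl root_prod_XsubC tk ?mem_head.
(* Some power of [s] is a multiple of [p] up to a scalar, so [s(q)] is central and nilpotent. *)
have evs : ev s = 0.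
  apply: (@central_nilpotent_eq0 _ _ ssH _ (size r)); first by move=> x; rewrite cev.
  have /dvdpP[g gE] : \prod_(k <- r) ('X - k%:P) %| s ^+ size r.
    by apply: dvs => k; rewrite mem_undup.
  have : ev (\prod_(k <- r) ('X - k%:P)) = 0.
    have := evp; rewrite Dp linearZ /= mulr_algl => /eqP.
    by rewrite scaler_eq0 lead_coef_eq0 (negPf p0) /= => /eqP.
  by move=> ev0; rewrite -rmorphXn gE rmorphM /= -/ev ev0 mulr0.
pose n := size ks; pose a (i : 'I_n) := ks`_i.
have ainj : injective a.
  by move=> i j /eqP; rewrite nth_uniq ?undup_uniq // => /eqP/val_inj.
have sE : s = \prod_i ('X - (a i)%:P) by rewrite /s (big_nth 0) big_mkord.
pose c i := \prod_(j | j != i) (a i - a j).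
have c0 i : c i != 0.
  by apply/prodf_neq0 => j ji; rewrite subr_eq0 (inj_eq ainj) eq_sym.
pose l i : {poly K} := (c i)^-1 *: \prod_(j | j != i) ('X - (a j)%:P).
have lE i j : (l i).[a j] = (i == j)%:R.
  rewrite /l hornerZ horner_prod; have [->|ij] := eqVneq i j.
    rewrite -[X in _ * X](_ : c j = _) ?mulVf //.
    by apply: eq_bigr => k _; rewrite !hornerE.
  rewrite (bigD1 j) /=; last by rewrite eq_sym.
  by rewrite hornerXsubC subrr mul0r mulr0.
(* Modulo [s], multiplication by [X] on [l i] is multiplication by [a i], since [(X - a i) l i] is a
   multiple of [s]. *)
have evl g i : ev g * ev (l i) = g.[a i] *: ev (l i).
  have /factor_theorem[h hE] : root (g - (g.[a i])%:P) (a i) by rewrite /root !hornerE subrr.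
  have gE : g = h * ('X - (a i)%:P) + (g.[a i])%:P by rewrite -hE subrK.
  have h0 : ev (h * ('X - (a i)%:P)) * ev (l i) = 0.
    rewrite -rmorphM -mulrA (_ : ('X - _) * l i = s * ((c i)^-1)%:P).
      by rewrite !rmorphM /= -/ev evs mul0r mulr0.
    by rewrite sE (bigD1 i) //= [RHS]mulrC mul_polyC /l -scalerAr.
  by rewrite {1}gE /ev rmorphD /= horner_algC mulrDl -/ev h0 add0r mulr_algl.
exists n, a, (fun i => ev (l i)); split.
- have sumC : \sum_i l i = 1.
    apply/eqP; rewrite -subr_eq0; apply/negPn/negP => nz.
    have ar : all (root (\sum_i l i - 1)) ks.
      apply/allP => k /(nthP 0)[i ik <-]; rewrite -[ks`_i]/(a (Ordinal ik)) /root !hornerE.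
      rewrite horner_sum (bigD1 (Ordinal ik)) //= lE eqxx big1 ?addr0 ?subrr // => j ji.
      by rewrite lE (negPf ji).
    have := max_poly_roots nz ar (undup_uniq _); apply/negP; rewrite -leqNgt.
    have n0 : (0 < n)%N.
      rewrite lt0n; apply: contraNneq (oner_neq0 H) => n0.
      have s1 : s = 1 by rewrite /s (size0nil n0) big_nil.
      by apply/eqP; have := evs; rewrite s1 /ev rmorph1.
    apply: leq_trans (size_polyD _ _) _; rewrite size_polyN geq_max size_poly1 n0 andbT.
    apply: leq_trans (size_sum _ _ _) _; apply/bigmax_leqP => i _.
    apply: leq_trans (size_scale_leq _ _) _.
    have := size_prod_XsubC ks id; rewrite -/s sE (bigD1 i) //=.
    rewrite size_Mmonic ?polyXsubC_eq0 ?monic_prod_XsubC // size_XsubC.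
    by rewrite -[size ks]/n add2n => -[->].
  by rewrite -linear_sum sumC rmorph1.
- by move=> i; rewrite evl lE eqxx scale1r.
- by move=> i; rewrite -{1}(horner_algX q) -/ev evl hornerX.
- by move=> i x; rewrite cev.
Qed.
End Spectrum.

(** * The trace of the squared antipode is nonzero *)

Section Nonvanishing.
Variables (K : closedFieldType) (H : hopfAlgType K).
Hypothesis charK0 : [pchar K] =i pred0.
Hypothesis ssH : semisimple H.
Variable L : H.
Hypothesis LP : normalized_integral L.
Local Notation S := (@antipode K H).

(** Let [w'] represent [rlambda] through the symmetric form [regchar]. The Nakayama relation of
    [rlambda] then reads [y w' = w' S^2(y)], and nondegeneracy of [rlambda] makes [w'] invertible.
    Both trace formulas evaluate [rlambda(h) = tr(x |-> S^2(x) h)], at [h = w y] and at [h = 1]. *)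
Lemma antipode2_inner : exists w w' : H,
  [/\ w * w' = 1, w' * w = 1, forall x, S (S x) = w * x * w',
      forall y, ltrace (fun x => w * x * y) = regchar y & ltrace (fun x => S (S x)) = regchar w'].
Proof.
have llr := @lin_rlambda K H; have lr := @lin_regchar K H.
have [w' w'E] := riesz_regchar charK0 ssH llr.
have comm y : y * w' = w' * S (S y).
  apply/eqP; rewrite -subr_eq0; apply/eqP/(regchar_nd charK0 ssH) => x.
  rewrite mulrBl -scaleN1r addrC lr; apply/eqP.
  rewrite /GRing.scale /= mulN1r addrC subr_eq0; apply/eqP.
  by rewrite -[in RHS]mulrA -w'E -(rlambda_nakayama LP) w'E mulrA [RHS]regcharC mulrA.
have inj x : w' * x = 0 -> x = 0.
  move=> wx; apply: (rlambda_ndl LP) => y.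
  by rewrite w'E mulrA wx mul0r -(scale0r (0 : H)) (linZ lr) scale0r.
have lw : lin (fun x : H => w' * x) by solve_lin.
have [w w'w] := lin_inj_surj lw inj 1.
have ww' : w * w' = 1.
  apply/eqP; rewrite -subr_eq0; apply/eqP/inj.
  by rewrite mulrBr mulrA w'w mul1r mulr1 subrr.
have S2 x : S (S x) = w * x * w' by rewrite -mulrA comm mulrA ww' mul1r.
exists w, w'; split=> //; last by rewrite -[w']mulr1 -w'E rlambda_ltrace; apply: eq_ltrace => x; rewrite mulr1.
move=> y; have := rlambda_ltrace (w * y); rewrite w'E mulrA w'w mul1r => ->.
by apply: eq_ltrace => x; rewrite S2 -!mulrA [w' * _]mulrA w'w mul1r.
Qed.

Lemma ltrace_antipode2_neq0 : ltrace (fun x => S (S x)) != 0.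
Proof.
have [w [w' [ww' w'w S2 trw ->]]] := antipode2_inner.
have [N N0 SN] := antipode_finite_order LP.
(* The factor 2 ensures [0 < M.-1], so that the trace formula covers the power [V^(M-1)]. *)
pose M := (2 * N)%N; have M1 : (1 < M)%N by rewrite /M -(prednK N0) mulnS.
have M0 : (0 < M)%N by apply: ltnW.
have [z pz] := prim_root_exists charK0 M0.
have w'wX k : w' ^+ k * w ^+ k = 1.
  by elim: k => [|k IHk]; rewrite ?mulr1 // exprS exprSr mulrA -[_ * w ^+ k]mulrA IHk mulr1.
have SM x : iter M (fun x => S (S x)) x = x by rewrite /M mul2n -addnn iterD !SN.
have SX k x : iter k (fun x => S (S x)) x = w ^+ k * x * w' ^+ k.
  elim: k => [|k IHk]; first by rewrite !expr0 mul1r mulr1.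
  by rewrite iterS IHk S2 exprS exprSr !mulrA.
pose q := w ^+ M.
have cq x : q * x = x * q by rewrite -{2}(SM x) SX -[RHS]mulrA w'wX mulr1.
have [n [a [e [e1 ee qe ce]]]] := central_spectrum ssH cq.
have term (i : 'I_n) : exists ds : nat * seq nat, [/\ (0 < ds.1)%N,
    ltrace (fun x => w' * x * e i) =
      (\sum_(a <- ds.2) z ^+ a) * (\sum_(a <- ds.2) z ^+ (a * M.-1)) / ds.1%:R
  & e i != 0 -> \sum_(a <- ds.2) z ^+ a != 0].
  have [ei0|ei0] := eqVneq (e i) 0.
    exists (1%N, [::]); split => //; rewrite big_nil !mul0r.
    rewrite (@eq_ltrace _ _ _ (fun x : H => 0 *: x)) ?ltraceZ ?mul0r // => x.
    by rewrite ei0 mulr0 scale0r.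
  have qX x : w ^+ M * x * e i = a i *: (x * e i).
    by rewrite -/q cq -mulrA qe -scalerAr.
  have ai0 : a i != 0.
    apply: contraNneq ei0 => ai0; rewrite -[e i]mul1r -(w'wX M) -mulrA qe ai0 scale0r mulr0 //.
  (* Dividing [w] by an [M]-th root of the eigenvalue makes [x |-> g^-1 w x e_i] an operator of
     order dividing [M] on [H e_i]. *)
  have [g gM] : exists g : K, g ^+ M = a i.
    have /closed_rootP[g] : size ('X^M - (a i)%:P) != 1 by rewrite size_XnsubC // eqSS -lt0n.
    by rewrite /root !hornerE subr_eq0 => /eqP; exists g.
  have g0 : g != 0 by apply: contraNneq ai0 => g0; rewrite -gM g0 expr0n eqn0Ngt M0.
  pose V := mxl (fun x => g^-1 *: (w * x * e i)).
  have VX k : (0 < k)%N -> V ^+ k = mxl (fun x => g^-1 ^+ k *: (w ^+ k * x * e i)).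
    case: k => // k _; elim: k => [|k IHk]; first by rewrite expr1.
    rewrite exprS IHk -[_ * _]/(_ *m _) -mxl_comp; last by solve_lin.
    apply: eq_mxl => x; rewrite -!scalerAr -!scalerAl scalerA -exprS; congr (_ *: _).
    by rewrite [w ^+ k.+2]exprS -!mulrA ee.
  have VM : V ^+ M.+1 = V.
    rewrite VX //; apply: eq_mxl => x.
    rewrite [w ^+ _]exprS -[w * _ * x]mulrA -[w * _ * e i]mulrA qX -scalerAr scalerA mulrA.
    by rewrite exprS -mulrA exprVn gM mulVf // mulr1.
  have [s sE] := mxtrace_exp_roots pz VM.
  pose d := \rank (mxl (fun x => e i * x)).
  have dE : regchar (e i) = d%:R.
    by rewrite /regchar ltrace_idempotent //; [solve_lin | move=> x; rewrite mulrA ee].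
  have d0 : (0 < d)%N.
    rewrite lt0n mxrank_eq0; apply: contraNneq ei0 => /mxl_eq0 r0.
    by rewrite -[e i]mulr1; apply/eqP/(r0 _ 1); solve_lin.
  have trV : \sum_(a <- s) z ^+ a = g^-1 * d%:R.
    rewrite -dE -trw -ltraceZ -mxtrace_mxl -/V -[V]expr1 sE //.
    by apply: eq_bigr => b _; rewrite muln1.
  (* The power [V^(M-1)] is [x |-> g w' x e_i]. The factor [g] cancels in the product of both
     traces, leaving [d] times the wanted one. *)
  have trV' : \sum_(a <- s) z ^+ (a * M.-1) = g * ltrace (fun x => w' * x * e i).
    rewrite -sE -?ltraceZ -?mxtrace_mxl ?VX ?ltn_predRL //; congr mxtrace; apply: eq_mxl => x.
    have -> : w ^+ M.-1 * x * e i = a i *: (w' * x * e i).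
      rewrite -[w' * x * _]mulrA scalerAr -qX -{2}[M]prednK // exprS.
      by rewrite !mulrA w'w mul1r.
    by rewrite scalerA -gM -{2}[M]prednK // exprSr mulrA exprVn mulVf ?mul1r // expf_neq0.
  have dn0 : d%:R != 0 :> K by rewrite natr_eq0_char0 // -lt0n.
  exists (d, s); split => //=; last by rewrite trV mulf_neq0 ?invr_eq0.
  by rewrite trV trV' mulrACA mulVf // mul1r mulrC mulKf.
have [ds dsP] := fin_all_exists term.
have [i0 ei0] : exists i, e i != 0.
  apply/existsP; apply: contraNT (oner_neq0 H) => /existsPn e0.
  by rewrite -e1 big1 // => i _; apply/eqP/negPn/e0.
suff -> : regchar w' = \sum_i (\sum_(a <- (ds i).2) z ^+ a) * (\sum_(a <- (ds i).2) z ^+ (a * M.-1)) / (ds i).1%:R.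
  apply: (sum_norm_neq0 charK0 (i0 := i0) pz) => [i|].
    by case: (dsP i).
  by case: (dsP i0) => _ _ ->.
transitivity (ltrace (fun x => \sum_i w' * x * e i)).
  by apply: eq_ltrace => x; rewrite -mulr_sumr e1 mulr1.
by rewrite ltrace_sum; apply: eq_bigr => i _; case: (dsP i).
Qed.
End Nonvanishing.

(** * The regular character of the dual *)

Section RegularCharacter.
Variables (K : fieldType) (H : hopfAlgType K).
Implicit Types (f : H -> K^o).
Local Notation S := (@antipode K H).
Local Notation e_ := (vbasis {:H}).

(** The standard left action of the convolution algebra on [H]. *)
Definition hit f (x : H) : H := Sw (fun a b => (f b : K) *: a) x.

Lemma lin_hit f : lin (hit f).
Proof. exact: Sw_lin. Qed.

Lemma hit_conv f g x : lin f -> lin g ->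
  hit (fun y => Sw (fun a b => (f a * g b : K) : K^o) y) x = hit f (hit g x).
Proof.
move=> lf lg; rewrite {3}/hit (Sw_push _ _ (lin_hit _)) {1}/hit.
transitivity (Sw (fun a b => Sw (fun c d => (f c * g d : K) *: a) b) x).
  apply: eq_Sw => a b; rewrite (@Sw_push _ _ K^o _ (fun k => (k : K) *: a)) //; solve_lin.
rewrite -(@SwA _ _ _ (fun a c d => (f c * g d : K) *: a)); try by solve_lin.
apply: eq_Sw => a d; rewrite (linZ (lin_hit _)) /hit -SwZ; apply: eq_Sw => a1 a2.
by rewrite scalerA mulrC.
Qed.

(* The character of the regular representation of the dual, as an element of [H]. *)
Definition regtr : H := \sum_(i < \dim {:H}) legl i e_`_i.

Lemma regtrE f : lin f -> f regtr = ltrace (hit f).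
Proof.
move=> lf; rewrite (lin_sum lf); apply: eq_bigr => i _.
rewrite /legl /hit Sw_push // (Sw_push _ _ (@lin_coord _ _ _ e_ i)).
apply: (@eq_Sw _ _ K^o) => a b; rewrite (linZ lf) linearZ /=; exact: mulrC.
Qed.

Lemma Sw_legr (W : vectType K) (F : H -> H -> W) h : bil F ->
  Sw F h = \sum_(k < \dim {:H}) F (hit (coord e_ k) h) e_`_k.
Proof.
move=> [l1 l2]; rewrite /hit.
under [RHS]eq_bigr => k _ do rewrite (Sw_push _ _ (l1 _)).
rewrite -Sw_sum; apply: eq_Sw => a b; rewrite {1}(basisE b) (lin_sum (l2 a)).
by apply: eq_bigr => k _; rewrite (linZ (l2 a)) (linZ (l1 _)).
Qed.

Lemma counit_regtr : counit regtr = (\dim {:H})%:R.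
Proof.
rewrite (regtrE (@lin_counit0 _ _)) -ltrace_id; apply: eq_ltrace => x.
by rewrite /hit (Sw_counitr _ (@lin_id _ _)).
Qed.

Lemma lambda_regtr : lambda regtr = ltrace (fun x => S (S x)).
Proof.
have ll := @lin_lambda K H.
rewrite (regtrE ll) (@eq_ltrace _ _ _ (fun x : H => (lambda x : K) *: 1)).
  by rewrite (ltrace_rank1 _ ll) /lambda; apply: eq_ltrace => x; rewrite mul1r.
by move=> x; rewrite -lambda_left_integral.
Qed.

(** [S^2] preserves the coproduct and is its own inverse, so it conjugates [hit f] into the operator
    of [f] composed with [S^2]; the traces agree. *)
Lemma antipode2_regtr : (forall y, S (S (S (S y))) = y) -> S (S regtr) = regtr.
Proof.
move=> S4; apply: coordP => j; pose f : H -> K^o := coord e_ j.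
have lf : lin f by exact: lin_coord.
rewrite -/(f _) -/(f regtr) (@regtrE (fun x => f (S (S x)))); last by solve_lin.
rewrite (@regtrE f) //.
transitivity (ltrace (fun x => S (S (hit f (S (S x)))))).
  apply: eq_ltrace => x; rewrite /hit Sw_antipode; last by split; solve_lin.
  rewrite Sw_antipode; last by split; solve_lin.
  rewrite (@Sw_push _ _ _ _ (fun z => S (S z))); last by solve_lin.
  by apply: eq_Sw => a b; rewrite !linearZ /= S4.
rewrite (@ltraceC _ _ _ (fun x => hit f (S (S x))) (fun x => S (S x))); last by solve_lin.
  by apply: eq_ltrace => x; rewrite S4.
by apply: lin_comp; [exact: lin_hit | solve_lin].
Qed.

(* A representation [M] of the dual [A] satisfies [M (x) A = A^(dim M)], by means of
   [x (x) y |-> x_1 (x) x_2 y]; here [M = A]. *)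
Lemma regtr_sqr : regtr * regtr = (\dim {:H})%:R *: regtr.
Proof.
apply: coordP => j; pose f : H -> K^o := coord e_ j.
have lf : lin f by exact: lin_coord.
rewrite -/(f _) -/(f (_ *: _)) (linZ lf) [in RHS]regtrE //.
have lh := lin_hit f.
pose tau h : K^o := ltrace (fun y => hit f (h * y)).
have lt : lin tau by apply: lin_ltrace => x; solve_lin.
(* For the functional [y |-> f(b y)], [hit] sends [y] to [S(b_1) hit f (b_2 y)]; cyclicity of the
   trace moves [S(b_1)] behind [b_2]. *)
have fb b : f (b * regtr) = Sw (fun b1 b2 => tau (b2 * S b1)) b.
  rewrite (@regtrE (fun y => f (b * y))); last by solve_lin.
  transitivity (ltrace (fun y => Sw (fun b1 b2 => S b1 * hit f (b2 * y)) b)).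
    apply: (@eq_ltrace K H) => y; rewrite /hit.
    transitivity (Sw (fun b1 b2 => Sw (fun p q => Sw (fun c d => (f (q * d) : K) *: (S b1 * p * c)) y) b2) b).
      rewrite -(@SwA _ _ _ (fun b1 p q => Sw (fun c d => (f (q * d) : K) *: (S b1 * p * c)) y)); try by solve_lin.
      rewrite -(@Sw_counitl _ _ _ (fun b => Sw (fun c d => (f (b * d) : K) *: c) y));
  last by solve_lin.
      apply: eq_Sw => z q.
      rewrite (@Sw_antipodel _ _ _ (fun u => Sw (fun c d => (f (q * d) : K) *: (u * c)) y));
  last by solve_lin.
      by congr (_ *: _); apply: eq_Sw => c d; rewrite mul1r.
    apply: eq_Sw => b1 b2; rewrite SwM; last by split; solve_lin.
    rewrite (@Sw_push _ _ _ _ (fun u => S b1 * u)); last by solve_lin.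
    apply: eq_Sw => p q; rewrite (@Sw_push _ _ _ _ (fun u => S b1 * u)); last by solve_lin.
    by apply: eq_Sw => c d; rewrite -scalerAr mulrA.
  rewrite /ltrace; under eq_bigr => i _.
    rewrite (Sw_push _ _ (@lin_coord _ _ _ e_ i)).
    over.
  rewrite -(@Sw_sum _ _ K^o); apply: (@eq_Sw _ _ K^o) => b1 b2.
  rewrite -[LHS]/(ltrace (fun y => S b1 * hit f (b2 * y))).
  rewrite (@ltraceC _ _ _ (fun y => hit f (b2 * y)) (fun y => S b1 * y)); [|by solve_lin|by solve_lin].
  by apply: (@eq_ltrace K H) => y; rewrite mulrA.
rewrite (@regtrE (fun x => f (x * regtr))); last by solve_lin.
pose B k := hit (coord e_ k : H -> K^o).
have lB k : lin (B k) by exact: lin_hit.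
have hitE x : hit (fun x => f (x * regtr)) x =
    \sum_(k < \dim {:H}) \sum_(l < \dim {:H}) (tau (e_`_k * S e_`_l) : K) *: B l (B k x).
  transitivity (Sw (fun a b => Sw (fun b1 b2 => (tau (b2 * S b1) : K) *: a) b) x).
    apply: eq_Sw => a b; rewrite fb.
    by rewrite (@Sw_push _ _ K^o _ (fun k => (k : K) *: a)) //; solve_lin.
  rewrite -(@SwA _ _ _ (fun a b1 b2 => (tau (b2 * S b1) : K) *: a)); try by solve_lin.
  rewrite Sw_legr; last by split; solve_lin.
  apply: eq_bigr => k _; rewrite Sw_legr //; split; solve_lin.
(* Exchanging the two [hit] operators under the trace reverses the legs, so that [tau(b_2 S(b_1))]
   becomes [tau(b_1 S(b_2))]. *)
transitivity (ltrace (fun x => \sum_(k < \dim {:H}) \sum_(l < \dim {:H}) (tau (e_`_k * S e_`_l) : K) *: B k (B l x))).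
  rewrite (eq_ltrace hitE) !ltrace_sum; apply: eq_bigr => k _; rewrite !ltrace_sum; apply: eq_bigr => l _.
  by rewrite !ltraceZ (ltraceC (lB k) (lB l)).
have E x : \sum_(k < \dim {:H}) \sum_(l < \dim {:H}) (tau (e_`_k * S e_`_l) : K) *: B k (B l x) = (tau 1 : K) *: x.
  transitivity (Sw (fun a b => Sw (fun b2 b1 => (tau (b2 * S b1) : K) *: a) b) x).
    rewrite -(@SwA _ _ _ (fun a b2 b1 => (tau (b2 * S b1) : K) *: a)); try by solve_lin.
    rewrite Sw_legr; last by split; solve_lin.
    rewrite exchange_big; apply: eq_bigr => l _.
    by rewrite Sw_legr //; split; solve_lin.
  rewrite -(@Sw_counitr _ _ _ (fun x => (tau 1 : K) *: x)); last by solve_lin.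
  apply: eq_Sw => a b.
  by rewrite (@Sw_antipoder _ _ _ (fun u => (tau u : K) *: a)); last by solve_lin.
rewrite (eq_ltrace E) ltraceZ ltrace_id mulrC; congr (_ * _).
by apply: (@eq_ltrace K H) => y; rewrite mul1r.
Qed.
End RegularCharacter.

(** * The integral as a multiple of the regular character of the dual *)

Section LarsonRadford.
Variables (K : closedFieldType) (H : hopfAlgType K).
Hypothesis charK0 : [pchar K] =i pred0.
Hypothesis ssH : semisimple H.
Variable L : H.
Hypothesis LP : normalized_integral L.
Local Notation S := (@antipode K H).
Local Notation n := (\dim {:H}).
Local Notation t := (regtr H).

Lemma dim_neq0 : n%:R != 0 :> K.
Proof.
rewrite natr_eq0_char0 // dimv_eq0; apply/eqP => e.
by have := @memvf _ _ (1 : H); rewrite e memv0 oner_eq0.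
Qed.

(** At [h = 1], [lambda_modulus] reads [lambda(1) 1 = lambda(1) g], and [lambda(1)] is the trace of
    [S^2]. *)
Lemma modulus_eq1 : modulus L = 1.
Proof.
have l1 : lambda (1 : H) != 0.
  rewrite (_ : lambda 1 = ltrace (fun x => S (S x))) ; first exact: (ltrace_antipode2_neq0 charK0 ssH LP).
  by rewrite /lambda; apply: eq_ltrace => x; rewrite mul1r.
have := lambda_modulus LP 1; rewrite Sw1; last by split; have ll := @lin_lambda K H; solve_lin.
by move/(scalerI l1) => <-.
Qed.

Lemma antipode4_id y : S (S (S (S y))) = y.
Proof. by have := antipode4_modulus LP y; rewrite modulus_eq1 mulr1 mul1r. Qed.

(* With [k], [r], [s] the ranks of [p = (1 - S^2) / 2], [e = t / n] and [e p], comparing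
   [tr(S^2) = n tr(e S^2)] gives [n - 2k = n (r - 2s)], whence [k = 0] or [k = n]. *)
Lemma regtr_integral : t = n%:R *: L.
Proof.
have nz k : (k%:R == 0 :> K) = (k == 0%N) by rewrite natr_eq0_char0.
have natK a b : a%:R = b%:R :> K -> a = b.
  wlog ab : a b / (a <= b)%N => [hw e|].
    by have [/hw/(_ e)//|/ltnW/hw/(_ (esym e))] := leqP a b.
  by move/esym/eqP; rewrite -subr_eq0 -natrB // nz subn_eq0 => ba; apply/eqP; rewrite eqn_leq ab.
have n0 := dim_neq0.
have ll := @lin_lambda K H.
pose e := n%:R^-1 *: t.
have ee : e * e = e by rewrite /e -scalerAl -scalerAr regtr_sqr [_ *: (n%:R *: _)]scalerA mulVf // scale1r.
have ce : counit e = 1 by rewrite /e linearZ /= counit_regtr mulVf.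
have S2e : S (S e) = e by rewrite /e !linearZ /= antipode2_regtr // => y; rewrite antipode4_id.
have two0 : 2%:R != 0 :> K by rewrite nz.
pose p x := 2%:R^-1 *: (x - S (S x)).
have lp : lin p.
  by apply: lin_scaler => a x y; rewrite !linearP /= addrACA -scalerDr.
have Sp x : S (S (p x)) = - p x.
  by rewrite /p 2!linearZ /= 2!linearB /= antipode4_id -scalerN opprB.
have pp x : p (p x) = p x.
  rewrite {1}/p Sp opprK -mulr2n -scaler_nat scalerA mulVf // scale1r //.
have pe x : p (e * x) = e * p x.
  by rewrite /p !antipodeM S2e -scalerAr mulrBr.
have S2E x : S (S x) = x - 2%:R *: p x.
  by rewrite /p scalerA mulfV // scale1r opprB addrC subrK.
pose k := \rank (mxl p); pose r := \rank (mxl (fun x => e * x)).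
pose s := \rank (mxl (fun x => e * p x)).
have trS : ltrace (fun x => S (S x)) = n%:R - 2%:R * k%:R.
  by rewrite (eq_ltrace S2E) ltraceB ltrace_id ltraceZ (ltrace_idempotent lp pp).
have tre : ltrace (fun x => e * x) = r%:R.
  by rewrite ltrace_idempotent //; [solve_lin | move=> x; rewrite mulrA ee].
have treS : lambda e = r%:R - 2%:R * s%:R.
  rewrite /lambda (@eq_ltrace _ _ _ (fun x => e * x - 2%:R *: (e * p x))) => [|x]; last first.
    by rewrite S2E mulrBr scalerAr.
  rewrite ltraceB ltraceZ tre (@ltrace_idempotent _ _ (fun x => e * p x)) //; first by solve_lin.
  by move=> x; rewrite pe pp mulrA ee.
have lame : n%:R * lambda e = n%:R - 2%:R * k%:R.
  by rewrite /e (linZ ll) lambda_regtr -trS mulrA mulfV // mul1r.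
have kn : (k <= n)%N by exact: rank_leq_row.
have k2n : (2 * k)%N <> n.
  by move=> e2; have /eqP := ltrace_antipode2_neq0 charK0 ssH LP; rewrite trS -natrM e2 subrr.
(* The identity [n - 2k = n (r - 2s)] without subtractions, so that it descends from [K] to natural
   numbers. *)
have eqn : (n * r + 2 * k = n + n * (2 * s))%N.
  apply: natK; rewrite [in LHS]natrD [in RHS]natrD !natrM; apply/eqP; rewrite -subr_eq0; apply/eqP.
  have := lame; rewrite treS mulrBr => /eqP; rewrite -subr_eq0 => /eqP <-.
  by rewrite opprB opprD [- _ - _]addrC addrACA.
have p1 : p 1 = 0 by rewrite /p !antipode1 subrr scaler0.
(* Otherwise [p] would be the identity, whereas it kills 1. *)
have kneq : k <> n.
  move=> kn'; have pu : mxl p \in unitmx by rewrite -row_free_unit /row_free -/k kn'.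
  have : mxl p = 1%:M.
    by apply: (can_inj (mulKmx pu)); rewrite mulmx1 -mxl_comp //; apply: eq_mxl.
  rewrite -mxl_id => /matrixP pid; have : p 1 = 1.
    rewrite (basisE (1 : H)) (lin_sum lp); apply: eq_bigr => j _; rewrite (linZ lp); congr (_ *: _).
    by apply: coordP => i; have := pid i j; rewrite !mxE.
  by rewrite p1 => /esym/eqP; rewrite oner_eq0.
have k0 : k = 0%N.
  (* If [j = 1 + 2s - r] is positive, then [n j = 2k]. The value 1 contradicts [k2n], and a larger
     one forces [k = n]. *)
  have [sr|rs] := leqP (1 + 2 * s) r.
    have : (n * (1 + 2 * s) <= n * r)%N by rewrite leq_mul2l sr orbT.
    rewrite mulnDr muln1 -eqn -{2}[(n * r)%N]addn0 leq_add2l leqn0 muln_eq0 /=.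
    by move/eqP.
  have nj : (n * (1 + 2 * s - r) = 2 * k)%N.
    by rewrite mulnBr mulnDr muln1 -eqn addKn.
  move: nj; rewrite -subn_gt0 in rs; case: (_ - r)%N rs => [//|[|j]] _.
    by rewrite muln1 => /esym/k2n.
  move=> nj; exfalso; apply: kneq; apply/eqP; rewrite eqn_leq kn /=.
  by rewrite -(leq_pmul2l (isT : 0 < 2)%N) -nj mulnC leq_mul2l orbT.
have p0 x : p x = 0.
  by apply: mxl_eq0 => //; apply/eqP; rewrite -mxrank_eq0 -/k k0.
have s0 : s = 0%N.
  rewrite /s (@eq_mxl _ _ _ (fun _ => 0)); last by move=> x; rewrite p0 mulr0.
  by apply/eqP; rewrite mxrank_eq0; apply/eqP/matrixP => i j; rewrite !mxE linear0.
have r1 : r = 1%N.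
  move: eqn; rewrite k0 s0 !muln0 !addn0 => /eqP; rewrite -{2}[n]muln1 eqn_pmul2l; first by move/eqP.
  by rewrite lt0n -nz.
have [hL Lh eL] := LP.
have eLE : e * L = L by rewrite hL ce scale1r.
have LeE : L * e = L by rewrite Lh ce scale1r.
have LLE : L * L = L by rewrite hL eL scale1r.
suff -> : L = e by rewrite /e scalerA mulfV // scale1r.
(* An idempotent of trace [r - 1 = 0], hence of rank 0. *)
pose f := e - L.
have ff : f * f = f by rewrite /f mulrBl !mulrBr ee eLE LeE LLE subrr subr0.
have : ltrace (fun x => f * x) = 0.
  rewrite (@eq_ltrace _ _ _ (fun x => e * x - (counit x : K) *: L)) => [|x]; last by rewrite mulrBl Lh.
  by rewrite ltraceB tre r1 (ltrace_rank1 _ (@lin_counit0 _ _)) eL subrr.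
rewrite ltrace_idempotent; [|by solve_lin|by move=> x; rewrite mulrA ff].
move/eqP; rewrite nz mxrank_eq0 => /eqP/mxl_eq0 f0.
have : f * 1 = 0 by apply: f0; solve_lin.
by rewrite mulr1 /f => /eqP; rewrite subr_eq0 => /eqP.
Qed.

Lemma ltrace_hit (f : H -> K^o) : lin f -> ltrace (hit f) = n%:R * f L :> K.
Proof. by move=> lf; rewrite -regtrE // regtr_integral (linZ lf). Qed.

(** Up to the nonzero factor [n], evaluation at [L] is the trace of a representation of the dual,
    and traces are symmetric. *)
Lemma integral_cocommutative (f g : H -> K^o) : lin f -> lin g ->
  Sw (fun a b => (f a * g b : K) : K^o) L = Sw (fun a b => (g a * f b : K) : K^o) L.
Proof.
have key (f' g' : H -> K^o) : lin f' -> lin g' ->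
    n%:R * (Sw (fun a b => (f' a * g' b : K) : K^o) L : K) = ltrace (fun x => hit f' (hit g' x)).
  move=> lf lg; pose h x : K^o := Sw (fun a b => (f' a * g' b : K) : K^o) x.
  have lh : lin h by exact: Sw_lin.
  rewrite -[Sw _ L]/(h L) -ltrace_hit //; apply: eq_ltrace => x.
  exact: hit_conv.
move=> lf lg; apply: (mulfI dim_neq0); rewrite (key f g) // (key g f) //.
by apply: ltraceC; exact: lin_hit.
Qed.
End LarsonRadford.

(** * The two trace formulas *)

Section FinMatrix.
Variables (K : fieldType) (I : finType).

(** Matrices indexed by any finite type; the index sets below are pairs and tuples. *)
Definition fmx (F : I -> I -> K) : 'M[K]_#|I| := \matrix_(u, v) F (enum_val u) (enum_val v).

Lemma eq_fmx F G : (forall i j, F i j = G i j) -> fmx F = fmx G.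
Proof. by move=> e; apply/matrixP => u v; rewrite !mxE e. Qed.

Lemma fmxM F G : fmx F *m fmx G = fmx (fun i j => \sum_k F i k * G k j).
Proof.
apply/matrixP => u v; rewrite !mxE [RHS](reindex (@enum_val _ I)) /=.
  by apply: eq_bigr => k _; rewrite !mxE.
by exists enum_rank => x _; rewrite ?enum_valK ?enum_rankK.
Qed.

Lemma fmx1 : fmx (fun i j => (i == j)%:R) = 1%:M.
Proof. by apply/matrixP => u v; rewrite !mxE (inj_eq enum_val_inj). Qed.

Lemma mxtrace_fmx F : \tr (fmx F) = \sum_i F i i.
Proof.
rewrite [RHS](reindex (@enum_val _ I)) /=; first by apply: eq_bigr => k _; rewrite !mxE.
by exists enum_rank => x _; rewrite ?enum_valK ?enum_rankK.
Qed.
End FinMatrix.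

Lemma big_tupleS (R : nmodType) (T : finType) n (F : seq T -> R) :
  \sum_(t : n.+1.-tuple T) F t = \sum_a \sum_(t : n.-tuple T) F (a :: t).
Proof.
rewrite pair_big /= (reindex (fun p : T * n.-tuple T => [tuple of p.1 :: p.2])) //=.
exists (fun t => (thead t, [tuple of behead t])) => [[a t] _|t _].
  by congr pair; apply: val_inj.
by apply: val_inj; rewrite [in RHS](tuple_eta t).
Qed.

(** An alias of the space of functionals, made to carry the convolution product. *)
Definition dual (K : fieldType) (H : hopfAlgType K) := 'Hom(H, K^o).
HB.instance Definition _ (K : fieldType) (H : hopfAlgType K) :=
  GRing.Zmodule.copy (dual H) 'Hom(H, K^o).

Section Dual.
Variables (K : fieldType) (H : hopfAlgType K).
Implicit Types f g k : dual H.

Definition ev f (h : H) : K := (f : 'Hom(H, K^o)) h.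

Definition mkdual (f : H -> K^o) (lf : lin f) : dual H := linfun (pack_lin lf).

Lemma mkdualE (f : H -> K^o) (lf : lin f) h : ev (mkdual lf) h = f h.
Proof. by rewrite /ev lfunE. Qed.

Lemma dualP f g : (forall h, ev f h = ev g h) -> f = g.
Proof. by move=> e; apply/lfunP. Qed.

Lemma lin_ev f : lin (ev f : H -> K^o).
Proof. exact: lin_linear. Qed.

Lemma evD f g h : ev (f + g) h = ev f h + ev g h.
Proof. exact: (@add_lfunE _ H K^o f g h). Qed.

Lemma ev0 h : ev 0 h = 0.
Proof. exact: (@zero_lfunE _ H K^o h). Qed.

Lemma ev_sum I (r : seq I) (P : pred I) (F : I -> dual H) h :
  ev (\sum_(i <- r | P i) F i) h = \sum_(i <- r | P i) ev (F i) h.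
Proof. exact: (@sum_lfunE _ H K^o _ r P F h). Qed.

Definition conv f g : dual H :=
  mkdual (@Sw_lin K H K^o (fun a b => ev f a * ev g b : K)).

Definition dual1 : dual H := mkdual (@lin_counit0 K H).

Lemma evM f g h : ev (conv f g) h = Sw (fun a b => (ev f a * ev g b : K) : K^o) h.
Proof. exact: mkdualE. Qed.

Lemma convA : associative conv.
Proof.
move=> f g k; apply: dualP => h; rewrite !evM.
have [lf [lg lk]] := (lin_ev f, (lin_ev g, lin_ev k)).
transitivity (Sw (fun a b => Sw (fun c d => (ev f a * (ev g c * ev k d) : K) : K^o) b) h).
  apply: (@eq_Sw _ _ K^o) => a b; rewrite evM.
  by rewrite (@Sw_push _ _ K^o K^o (fun x => ev f a * x : K)) //; solve_lin.
rewrite -(@SwA _ _ K^o (fun a c d => ev f a * (ev g c * ev k d) : K)); try by solve_lin.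
apply: (@eq_Sw _ _ K^o) => a d; rewrite evM.
rewrite (@Sw_push _ _ K^o K^o (fun x => (x : K) * ev k d : K)); last by solve_lin.
by apply: (@eq_Sw _ _ K^o) => b c; rewrite mulrA.
Qed.

Lemma conv1l : left_id dual1 conv.
Proof.
move=> f; apply: dualP => h; rewrite evM -[RHS](@Sw_counitl _ _ K^o (ev f) h (lin_ev f)).
by apply: (@eq_Sw _ _ K^o) => a b; rewrite mkdualE.
Qed.

Lemma conv1r : right_id dual1 conv.
Proof.
move=> f; apply: dualP => h; rewrite evM -[RHS](@Sw_counitr _ _ K^o (ev f) h (lin_ev f)).
by apply: (@eq_Sw _ _ K^o) => a b; rewrite mkdualE mulrC.
Qed.

Lemma convDl : left_distributive conv +%R.
Proof.
move=> f g k; apply: dualP => h; rewrite evD !evM /Sw /tlift -big_split; apply: eq_bigr => i _.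
rewrite -big_split; apply: eq_bigr => j _; by rewrite evD mulrDl scalerDr.
Qed.

Lemma convDr : right_distributive conv +%R.
Proof.
move=> f g k; apply: dualP => h; rewrite evD !evM /Sw /tlift -big_split; apply: eq_bigr => i _.
rewrite -big_split; apply: eq_bigr => j _; by rewrite evD mulrDr scalerDr.
Qed.

HB.instance Definition _ := GRing.Zmodule_isPzRing.Build (dual H) convA conv1l conv1r convDl convDr.

Lemma ev1 h : ev 1 h = counit h.
Proof. exact: mkdualE. Qed.

Lemma ev_mul f g h : ev (f * g) h = Sw (fun a b => (ev f a * ev g b : K) : K^o) h.
Proof. exact: evM. Qed.

Lemma hit_mul f g x : hit (ev (f * g)) x = hit (ev f) (hit (ev g) x).
Proof.
rewrite -(hit_conv x (lin_ev f) (lin_ev g)) /hit; apply: eq_Sw => a b.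
by rewrite ev_mul.
Qed.
End Dual.

Section Rep.
Variables (K : fieldType) (H : hopfAlgType K) (V : hmodule H).
Local Notation r := (\dim {:V}).
Local Notation v_ := (vbasis {:V}).

Lemma lin_coeff (i j : 'I_r) : lin (fun h => coord v_ i (haction V h v_`_j) : K^o).
Proof. by move=> a x y; rewrite !linearP /= add_lfunE scale_lfunE linearP. Qed.

Definition repmx : 'M[dual H]_r := \matrix_(i, j) mkdual (lin_coeff i j).
Local Notation X := repmx.

Lemma repmxE i j h : ev (X i j) h = coord v_ i (haction V h v_`_j).
Proof. by rewrite mxE mkdualE. Qed.

Lemma repmxM i j g h : ev (X i j) (g * h) = \sum_k ev (X i k) g * ev (X k j) h.
Proof.
rewrite repmxE hactionM comp_lfunE (basisE (haction V h v_`_j)) !linear_sum.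
by apply: eq_bigr => k _; rewrite !linearZ /= mulrC !repmxE.
Qed.

Lemma lin_iter_mul n : lin (@iter_mul K H n).
Proof. by case: n => [|n]; [exact: lin_id | exact: lin_linear]. Qed.

Lemma sweedler_powerS n (h : H) :
  sweedler_power n.+2 h = Sw (fun a b => a * sweedler_power n.+1 b) h.
Proof.
rewrite /sweedler_power /= Sw_tmap //; split => [v|u] a x y /=.
  by rewrite mulrDl scalerAl.
by rewrite lin_iter_mul mulrDr scalerAr.
Qed.

(** Convolution distributes the legs of [h] over the factors, and the matrix product composes their
    actions. *)
Lemma repmx_power n i j h : (0 < n)%N ->
  ev ((X ^+ n) i j) h = coord v_ i (haction V (sweedler_power n h) v_`_j).
Proof.
case: n => // n _; elim: n i j h => [|n IHn] i j h; first by rewrite expr1 repmxE.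
rewrite exprS mxE ev_sum sweedler_powerS.
pose F (a : H) : K^o := coord v_ i (haction V a v_`_j).
have lF : lin F by exact: lin_coeff.
rewrite -[RHS]/(F _) (Sw_push _ _ lF).
under eq_bigr => k _ do rewrite ev_mul.
rewrite -(@Sw_sum _ _ K^o); apply: (@eq_Sw _ _ K^o) => a b.
rewrite /F hactionM comp_lfunE (basisE (haction V (sweedler_power _ b) _)) !linear_sum.
by apply: eq_bigr => k _; rewrite !linearZ /= IHn repmxE mulrC.
Qed.

Lemma character_trace m h : (0 < m)%N ->
  character V (sweedler_power m h) = ev (\tr (X ^+ m)) h.
Proof.
move=> m0; rewrite /mxtrace ev_sum; apply: eq_bigr => i _.
by rewrite repmx_power // mxE /= passmx.vecof_delta mxE.
Qed.

Lemma repmx_trivial_power d : (0 < d)%N -> trivial_power V d -> X ^+ d = 1.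
Proof.
move=> d0 tp; apply/matrixP => i j; apply: dualP => h; rewrite repmx_power // tp linearZ /=.
rewrite coord_free ?(basis_free (vbasisP _)) // !mxE eq_sym; case: eqP => _; last by rewrite ev0 mulr0.
by rewrite ev1 mulr1.
Qed.
End Rep.

Section HeisenbergTrace.
Variables (K : fieldType) (H : hopfAlgType K) (r : nat).

(* A matrix of functionals acts on [H (x) K^r] through [hit]. *)
Definition hitmx (M : 'M[dual H]_r) : 'M[K]_#|{: 'I_r * 'I_(\dim {:H})}| :=
  fmx (fun p q : 'I_r * 'I_(\dim {:H}) => mxl (hit (ev (M p.1 q.1))) p.2 q.2).

Lemma mxl_hit_sum I (s : seq I) (F : I -> dual H) :
  mxl (hit (ev (\sum_(i <- s) F i))) = \sum_(i <- s) mxl (hit (ev (F i))).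
Proof.
apply/matrixP => i j; rewrite summxE.
under [RHS]eq_bigr => k _ do rewrite mxE.
rewrite mxE -linear_sum -Sw_sum; congr (coord _ _ _); apply: eq_Sw => a b.
by rewrite ev_sum scaler_suml.
Qed.

Lemma hitmxM M N : hitmx (M * N) = hitmx M * hitmx N.
Proof.
rewrite /hitmx -[RHS]/(_ *m _) fmxM; apply: eq_fmx => -[i a] [j b] /=.
rewrite (_ : (M * N) i j = \sum_k M i k * N k j); last by rewrite mxE.
rewrite mxl_hit_sum summxE [RHS](eq_bigr (fun p => (fun k c =>
  mxl (hit (ev (M i k))) a c * mxl (hit (ev (N k j))) c b) p.1 p.2)) => [|[]] //.
rewrite -(pair_bigA _ (fun k c => mxl (hit (ev (M i k))) a c * mxl (hit (ev (N k j))) c b)) /=.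
apply: eq_bigr => k _.
by rewrite (eq_mxl (hit_mul _ _)) (@mxl_comp _ _ (hit (ev (M i k))) (hit (ev (N k j)))) ?mxE //; apply: lin_hit.
Qed.

Lemma hitmx1 : hitmx 1 = 1.
Proof.
rewrite -[RHS]/(1%:M) -fmx1; apply: eq_fmx => -[i a] [j b] /=.
rewrite (_ : (1 : 'M[dual H]_r) i j = (i == j)%:R); last by rewrite mxE.
rewrite xpair_eqE; case: eqVneq => [_|_] /=.
  rewrite (@eq_mxl _ _ _ id) => [|x]; first by rewrite mxl_id mxE.
  rewrite /hit -[RHS](Sw_counitr _ (@lin_id _ H)).
  by apply: eq_Sw => u v; rewrite ev1.
rewrite mxE (_ : hit _ _ = 0) ?linear0 // /hit /Sw /tlift.
by apply: big1 => u _; apply: big1 => v _; rewrite ev0 scale0r scaler0.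
Qed.

Lemma hitmxX M n : hitmx (M ^+ n) = hitmx M ^+ n.
Proof. by elim: n => [|n IHn]; rewrite ?hitmx1 // !exprS hitmxM IHn. Qed.

Lemma mxtrace_hitmx M : \tr (hitmx M) = ltrace (hit (ev (\tr M))).
Proof.
rewrite mxtrace_fmx /= -mxtrace_mxl mxl_hit_sum raddf_sum /= pair_bigA /=.
exact: eq_bigr.
Qed.
End HeisenbergTrace.

(** * The indicator as a trace on a tensor power *)

Section CyclicTrace.
Variables (K : fieldType) (H : hopfAlgType K) (V : hmodule H).
Local Notation r := (\dim {:V}).
Local Notation X := (repmx V).
Variable L : H.
Hypothesis LL : L * L = L.
Hypothesis L1 : counit L = 1.
Hypothesis Lcocomm : forall f g : dual H, ev (f * g) L = ev (g * f) L.

(** For index sequences of length [m], [word (zip i j)] is the coefficient at [(i, j)] of the [m]-th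
    tensor power of [V]. *)
Definition word (s : seq ('I_r * 'I_r)) : dual H := \prod_(p <- s) X p.1 p.2.

(** This says that the tensor power of [V] is a representation; the induction splits off the first
    factor by multiplicativity of the coproduct. *)
Lemma wordM m (i k : seq 'I_r) g h : size i = m -> size k = m ->
  ev (word (zip i k)) (g * h) =
  \sum_(j : m.-tuple 'I_r) ev (word (zip i j)) g * ev (word (zip j k)) h.
Proof.
elim: m i k g h => [|m IHm] [|i0 i] [|k0 k] g h //=.
  move=> _ _; rewrite (big_pred1 [tuple]) => [|t]; last exact/esym/eqP/tuple0.
  by rewrite /word !big_nil !ev1 rmorphM.
move=> [si] [sk].
rewrite (@big_tupleS _ _ _ (fun j => ev (word (zip (i0 :: i) j)) g * ev (word (zip j (k0 :: k))) h)) /=.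
have wc p s : word (p :: s) = X p.1 p.2 * word s by rewrite /word big_cons.
rewrite wc ev_mul /= SwM; last first.
  have [l1 l2] := (lin_ev (X i0 k0), lin_ev (word (zip i k))).
  by split; solve_lin.
transitivity (\sum_j0 \sum_(j : m.-tuple 'I_r) Sw (fun a b => Sw (fun c d =>
   (ev (X i0 j0) a * ev (X j0 k0) c * (ev (word (zip i j)) b * ev (word (zip j k)) d) : K) : K^o) h) g).
  under [RHS]eq_bigr => j0 _ do rewrite -(@Sw_sum _ _ K^o).
  rewrite -(@Sw_sum _ _ K^o); apply: (@eq_Sw _ _ K^o) => a b.
  under [RHS]eq_bigr => j0 _ do rewrite -(@Sw_sum _ _ K^o).
  rewrite -(@Sw_sum _ _ K^o); apply: (@eq_Sw _ _ K^o) => c d.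
  rewrite repmxM IHm // mulr_suml; apply: eq_bigr => j0 _; rewrite mulr_sumr.
  exact: eq_bigr.
apply: eq_bigr => j0 _; apply: eq_bigr => j _; rewrite !wc !ev_mul /=.
rewrite (@Sw_push _ _ K^o K^o (fun x => (x : K) * _ : K)); last exact: lin_smull (@lin_id _ _).
apply: (@eq_Sw _ _ K^o) => a b.
rewrite (@Sw_push _ _ K^o K^o (fun x => _ * (x : K) : K)); last exact: lin_smulr (@lin_id _ _).
by apply: (@eq_Sw _ _ K^o) => c d; rewrite mulrACA.
Qed.

(** Matrix powers sum over paths. For [a = b] the paths close up, and the second index sequence is
    the first one rotated. *)
Lemma word_path m a b : (X ^+ m.+1) a b = \sum_(t : m.-tuple 'I_r) word (zip (a :: t) (rcons t b)).
Proof.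
elim: m a b => [|m IHm] a b.
  rewrite (big_pred1 [tuple]) => [|t]; last exact/esym/eqP/tuple0.
  by rewrite expr1 /word big_seq1.
rewrite exprS mxE (@big_tupleS _ _ _ (fun t => word (zip (a :: t) (rcons t b)))) /=.
apply: eq_bigr => c _; rewrite IHm mulr_sumr; apply: eq_bigr => t _.
by rewrite /word [RHS]big_cons.
Qed.

Variable m : nat.
Local Notation I := (m.+1.-tuple 'I_r).
Let shift (i : I) : I := [tuple of rot 1 i].
Let E (i j : I) : K := ev (word (zip i j)) L.

Lemma shift_inj : injective shift.
Proof. by move=> i j /(congr1 val)/= /rot_inj/val_inj. Qed.

Lemma shift_iter (i : I) : iter m.+1 shift i = i.
Proof.
suff it k : (k <= m.+1)%N -> val (iter k shift i) = rot k i.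
  by apply: val_inj; rewrite it // -{1}(size_tuple i) rot_size.
elim: k => [|k IHk] km; first by rewrite rot0.
by rewrite iterS /= IHk 1?ltnW //; apply: esym; apply: rotS; rewrite size_tuple.
Qed.

(** Rotation moves the first factor of the product to the end, which [Lcocomm] allows. *)
Lemma E_rot i j : E (shift i) (shift j) = E i j.
Proof.
rewrite /E /=; case: i j => -[//|i0 i] /= si [[//|j0 j] /= sj].
rewrite !rot1_cons zip_rcons; last by case/eqP: si => ->; case/eqP: sj => ->.
by rewrite /word big_rcons big_cons /= Lcocomm.
Qed.

(* [Q] is the action of [L] on the tensor power, and [P] is the cyclic shift. *)
Lemma cyclic_trace_mx : exists A : 'M[K]_#|{: I}|,
  A ^+ m.+2 = A /\ \tr A = ev (\tr (X ^+ m.+1)) L.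
Proof.
pose P := fmx (fun i j : I => (i == shift j)%:R : K); pose Q := fmx E.
have QQ : Q * Q = Q.
  rewrite -[LHS]/(Q *m Q) fmxM; apply: eq_fmx => i k.
  by rewrite /E -wordM ?size_tuple // LL.
have QP : Q *m P = fmx (fun i j => E i (shift j)).
  rewrite fmxM; apply: eq_fmx => i k; rewrite (bigD1 (shift k)) //= eqxx mulr1 big1 ?addr0 //.
  by move=> j /negPf ->; rewrite mulr0.
have PQ : P *m Q = Q *m P.
  rewrite QP fmxM; apply: eq_fmx => i k.
  under eq_bigr => j _ do rewrite -E_rot.
  rewrite -(reindex_inj shift_inj (P := xpredT) (F := fun j => (i == j)%:R * E j (shift k))) /=.
  rewrite (bigD1 i) //= eqxx mul1r big1 ?addr0 // => j; rewrite eq_sym => /negPf ->.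
  by rewrite mul0r.
have PX k : P ^+ k = fmx (fun i j => (i == iter k shift j)%:R).
  elim: k => [|k IHk]; first by rewrite fmx1.
  rewrite exprSr IHk -[_ * _]/(_ *m _) fmxM; apply: eq_fmx => i l.
  rewrite (bigD1 (shift l)) //= eqxx mulr1 big1 ?addr0 -?iterSr // => j /negPf ->.
  by rewrite mulr0.
have QX k : Q ^+ k.+1 = Q by elim: k => [|k IHk]; rewrite ?expr1 // exprS IHk.
(* With [m.+1] tensor factors, [P^(m+1) = 1]; as [Q] is idempotent and commutes with [P],
   [(Q P)^(m+2) = Q P]. *)
exists (Q * P); split.
  rewrite exprMn_comm; last exact/esym/PQ.
  rewrite QX exprSr PX (@eq_fmx _ _ _ (fun i j => (i == j)%:R)) ?fmx1 ?mul1r //.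
  by move=> i j; rewrite shift_iter.
rewrite -[Q * P]/(Q *m P) QP mxtrace_fmx /mxtrace ev_sum.
rewrite (@big_tupleS _ _ _ (fun i => ev (word (zip i (rot 1 i))) L)) /=.
apply: eq_bigr => a _; rewrite word_path ev_sum; apply: eq_bigr => t _.
by rewrite rot1_cons.
Qed.
End CyclicTrace.

(** * Arithmetic of [m] and [d], and the theorem *)

(** Let a prime [p] divide both numbers. The full power of [p] in [d] divides [m], hence the gcd,
    and one more factor [p] in the cofactor contradicts maximality. *)
Lemma large_coprime m d : (0 < m)%N -> (0 < d)%N -> large_compared_to m d ->
  coprime m (d %/ gcdn m d).
Proof.
move=> m0 d0 lmd; have g0 : (0 < gcdn m d)%N by rewrite gcdn_gt0 m0.
rewrite coprime_has_primes //; last by rewrite divn_gt0 // dvdn_leq // dvdn_gcdr.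
apply/hasPn => p; rewrite !mem_primes => /and3P[pp _ pd']; apply/negP => /and3P[_ _ pm].
have pd : (p %| d)%N by rewrite -(divnK (dvdn_gcdr m d)) dvdn_mulr.
have [q pq dE] := pfactor_coprime pp d0.
have := lmd p (logn p d) q pp pd pm; rewrite mulnC => /(_ dE).
rewrite -prime_coprime // => /(_ pq) pkm.
have : (p ^ (logn p d).+1 %| d)%N.
  rewrite -[X in (_ %| X)%N](divnK (dvdn_gcdr m d)) expnS dvdn_mul // dvdn_gcd pkm /=.
  exact: pfactor_dvdnn.
by rewrite pfactor_dvdn // ltnn.
Qed.

Lemma squarefree_large m d : (0 < d)%N -> squarefree d -> large_compared_to m d.
Proof.
move=> d0 sqf p k q pp pd pm dE npq.
case: k dE => [|[|k]] dE; rewrite ?expn1 ?dvd1n //.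
have : p = 1%N by apply: sqf; rewrite dE dvdn_mulr // dvdn_exp2l.
by move=> p1; rewrite p1 in pp.
Qed.

Theorem corollary3p2 (K : closedFieldType) (charK0 : [pchar K] =i pred0)
    (H : hopfAlgType K) (ssH : semisimple H)
    (Lambda : H) (LambdaP : normalized_integral Lambda)
    (V : hmodule H) (d : nat) (dP : has_exponent V d)
    (m : nat) (m_gt0 : (0 < m)%N) :
  (large_compared_to m d ->
     exists z : int, FS_indicator Lambda m (character V) = z%:~R) /\
  (squarefree d ->
     exists z : int, FS_indicator Lambda m (character V) = z%:~R).
Proof.
have [d0 Vd _] := dP.
suff large : large_compared_to m d ->
    exists z : int, FS_indicator Lambda m (character V) = z%:~R.
  by split=> [//|sqf]; apply: large; exact: squarefree_large.
move=> lmd; have cop := large_coprime m_gt0 d0 lmd; set e := (d %/ _)%N in cop.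
have [hL Lh eL] := LambdaP.
have g0 : (0 < gcdn m d)%N by rewrite gcdn_gt0 m_gt0.
have e0 : (0 < e)%N by rewrite divn_gt0 //; apply: dvdn_leq => //; exact: dvdn_gcdr.
have me0 : (0 < m * e)%N by rewrite muln_gt0 m_gt0.
(* One root of order [m e] carries both expressions: [z^e] has order [m] and [z^m] has order [e]. *)
have [z pz] := prim_root_exists charK0 me0.
have pm : m.-primitive_root (z ^+ e).
  by have := dvdn_prim_root pz (dvdn_mulr e (dvdnn m)); rewrite mulKn.
have pe : e.-primitive_root (z ^+ m).
  by have := dvdn_prim_root pz (dvdn_mull m (dvdnn e)); rewrite mulnK.
rewrite /FS_indicator character_trace //.
have Lcocomm (f g : dual H) : ev (f * g) Lambda = ev (g * f) Lambda.
  by rewrite !ev_mul (integral_cocommutative charK0 ssH LambdaP (lin_ev f) (lin_ev g)).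
have LL : Lambda * Lambda = Lambda by rewrite hL eL scale1r.
have [A [Am trA]] : exists A : 'M[K]_#|{: m.-tuple 'I_(\dim {:V})}|,
    A ^+ m.+1 = A /\ \tr A = ev (\tr (repmx V ^+ m)) Lambda.
  by rewrite -(prednK m_gt0); apply: cyclic_trace_mx.
have [s sE] := mxtrace_exp_roots pm Am.
pose B := hitmx (repmx V) ^+ m.
(* The operator [hitmx (repmx V)] has [d]-th power 1, and [m e] is the multiple [d (m / gcd(m, d))]
   of [d]. *)
have Be : B ^+ e = 1.
  rewrite -exprM (_ : (m * e = d * (m %/ gcdn m d))%N); last first.
    by rewrite /e !muln_divA ?dvdn_gcdl ?dvdn_gcdr // mulnC.
  by rewrite exprM -hitmxX (repmx_trivial_power d0 Vd) hitmx1 expr1n.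
have [t tE] := mxtrace_exp_roots pe (etrans (exprS B e) (etrans (congr1 _ Be) (mulr1 B))).
have n0 : (0 < \dim {:H})%N by rewrite lt0n -(natr_eq0_char0 charK0) dim_neq0.
have sE' : ev (\tr (repmx V ^+ m)) Lambda = \sum_(a <- s) z ^+ (e * a).
  by rewrite -trA -[A]expr1 sE //; apply: eq_bigr => a _; rewrite muln1 exprM.
(* The trace of [B] is [\dim {:H}] times the indicator, so that multiple is also a sum of [e]-th
   roots of unity. *)
rewrite sE'; apply: (cyclotomic_intersection charK0 (t := t) pz cop n0).
rewrite -sE' -(ltrace_hit charK0 ssH LambdaP (lin_ev _)) -mxtrace_hitmx hitmxX -/B -[B]expr1 tE //.
by apply: eq_bigr => a _; rewrite muln1 exprM.
Qed.
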